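(* Let $N(c)$ be a $(2m+1)$-dimensional $(\kappa,\mu)$-contact space form of constant $\varphi$-sectional curvature $c$, endowed with the connection $\overline{\widetilde{\nabla}}_XY=\widehat{\overline{\nabla}}_XY+a\pi(X)Y+b\pi(Y)X$, and let $M^n$, $n\ge 3$, be an $n$-dimensional submanifold of $N(c)$. Then for any integer $k$, $2\le k\le n$, and any point $x\in M$, \begin{align*} n(n-1)\|\widetilde H\|^2(x)\ge{}& n(n-1)\widetilde\Theta_k(x)-\frac{c+3}{4}(n-1)n-\frac{3(c-1)}{4}\|\widehat{P}\|^2+\frac{c+3-4\kappa}{2}(n-1)\|\xi^\top\|^2\\ &-\frac12\left[\|(\varphi h')^\top\|^2-\|(h')^\top\|^2+|\mathrm{tr}((h')^\top)|^2-|\mathrm{tr}((\varphi h')^\top)|^2\right]\\ &-2(n-1)\mathrm{tr}((h')^\top)-2(1-\mu)\left[g(\xi^\top,h'\xi^\top)-\mathrm{tr}((h')^\top)\|\xi^\top\|^2\right]\\ &+(n-1)b\lambda'-(n-1)b^2\|P^\top\|^2+b(n-1)n\,\pi(\widetilde H). \end{align*}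
   Context: **Ambient manifold.** A Riemannian manifold $(N^{2m+1},g)$ has an almost contact metric structure $(\varphi,\xi,\eta,g)$ if $\varphi$ is a $(1,1)$-tensor field, $\xi$ a vector field, $\eta$ a $1$-form with $\varphi^2X=-X+\eta(X)\xi$, $\eta(\xi)=1$, $\varphi\xi=0$, $\eta\circ\varphi=0$, $g(X,\varphi Y)=-g(\varphi X,Y)$, $g(X,\xi)=\eta(X)$. It is a contact metric manifold if $\Phi=d\eta$, where $\Phi(X,Y)=g(X,\varphi Y)$. Let $\widehat{\overline{\nabla}}$ be the Levi-Civita connection of $g$ and $\widehat{\overline{R}}$ its curvature tensor. The tensor $h'$ defined by $2h'=\mathcal L_\xi\varphi$ is symmetric, and $h'\xi=0$, $h'\varphi+\varphi h'=0$, $\widehat{\overline{\nabla}}\xi=-\varphi-\varphi h'$, and $h'$ and $\varphi h'$ are trace-free on $TN$. $N$ is a $(\kappa,\mu)$-contact metric manifold ($\kappa,\mu$ real constants) if $\widehat{\overline{R}}(X,Y)\xi=\kappa[\eta(Y)X-\eta(X)Y]+\mu[\eta(Y)h'X-\eta(X)h'Y]$. A $\varphi$-section is a plane spanned by $X,\varphi X$ with $X$ a unit vector orthogonal to $\xi$; its sectional curvature is a $\varphi$-sectional curvature. If a $(\kappa,\mu)$-contact metric manifold has constant $\varphi$-sectional curvature $c$ it is called a $(\kappa,\mu)$-contact space form $N(c)$, and its Levi-Civita curvature tensor is \begin{align*}\widehat{\overline{R}}(X,Y)Z={}&\tfrac{c+3}{4}[g(Y,Z)X-g(X,Z)Y]+\tfrac{c+3-4\kappa}{4}[\eta(X)\eta(Z)Y-\eta(Y)\eta(Z)X+g(X,Z)\eta(Y)\xi-g(Y,Z)\eta(X)\xi]\\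 &+\tfrac{c-1}{4}[2g(X,\varphi Y)\varphi Z+g(X,\varphi Z)\varphi Y-g(Y,\varphi Z)\varphi X]\\ &+\tfrac12[g(h'Y,Z)h'X-g(h'X,Z)h'Y+g(\varphi h'X,Z)\varphi h'Y-g(\varphi h'Y,Z)\varphi h'X]\\ &-g(X,Z)h'Y+g(Y,Z)h'X+\eta(X)\eta(Z)h'Y-\eta(Y)\eta(Z)h'X-g(h'X,Z)Y+g(h'Y,Z)X\\ &-g(h'Y,Z)\eta(X)\xi+g(h'X,Z)\eta(Y)\xi\\ &+\mu[\eta(Y)\eta(Z)h'X-\eta(X)\eta(Z)h'Y+g(h'Y,Z)\eta(X)\xi-g(h'X,Z)\eta(Y)\xi].\end{align*} **Connection.** $P$ is a vector field on $N$, $\pi(X)=g(P,X)$, $a,b$ are real constants, and $\overline{\widetilde{\nabla}}_XY=\widehat{\overline{\nabla}}_XY+a\pi(X)Y+b\pi(Y)X$. Put $\alpha'(X,Y)=(\widehat{\overline{\nabla}}_X\pi)(Y)$. **Submanifold.** For tangent $X,Y$ on $M$, $\overline{\widetilde{\nabla}}_XY=\widetilde\nabla_XY+\widetilde h(X,Y)$ is the decomposition into tangential part (induced connection $\widetilde\nabla$) and normal part $\widetilde h$; $\widetilde h$ equals the usual second fundamental form $\widehat h$. $\widetilde R(X,Y)Z=\widetilde\nabla_X\widetilde\nabla_YZ-\widetilde\nabla_Y\widetilde\nabla_XZ-\widetilde\nabla_{[X,Y]}Z$ and $\widetilde R(X,Y,Z,W)=g(\widetilde R(X,Y)Z,W)$.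 Let $e_1,\dots,e_n$ be an orthonormal basis of $T_xM$. $\widetilde H=\frac1n\sum_i\widetilde h(e_i,e_i)$. For a $2$-plane $\Pi$ with orthonormal basis $\{e_1,e_2\}$, $\widetilde K(\Pi)=\frac12[\widetilde R(e_1,e_2,e_2,e_1)-\widetilde R(e_1,e_2,e_1,e_2)]$. **$k$-Ricci curvature.** For a $k$-plane section $L\subset T_xM$ and a unit vector $X\in L$, choose an orthonormal frame $e_1,\dots,e_k$ of $L$ with $e_1=X$ and put $\widetilde{\mathrm{Ric}}_L(X)=\sum_{j=2}^k\widetilde K(e_1\wedge e_j)$. For $2\le k\le n$, $\widetilde\Theta_k(x)=\frac1{k-1}\inf\{\widetilde{\mathrm{Ric}}_L(X)\mid L,X\}$, where $L$ runs over all $k$-plane sections in $T_xM$ and $X$ over all unit vectors in $L$. **Notation.** $\lambda'=\mathrm{tr}(\alpha')=\sum_{i=1}^n\alpha'(e_i,e_i)$ (trace over $T_xM$). $\xi^\top$, $P^\top$ are the tangential parts of $\xi$, $P$; $\widehat PX$, $(h')^\top X$, $(\varphi h')^\top X$ are the tangential parts of $\varphi X$, $h'X$, $\varphi h'X$ for tangent $X$; $\|\vartheta\|^2=\sum_{i,j=1}^n g(e_i,\vartheta e_j)^2$ and $\mathrm{tr}(\vartheta)=\sum_{i=1}^n g(e_i,\vartheta e_i)$ for $\vartheta\in\{\widehat P,(h')^\top,(\varphi h')^\top\}$. *)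

(* Defs.v *)
From mathcomp Require Import all_boot all_order all_algebra.
From mathcomp Require Import all_classical all_reals all_analysis.
Import Order.TTheory GRing.Theory Num.Theory.
Import numFieldNormedType.Exports.

Set Implicit Arguments.
Unset Strict Implicit.
Unset Printing Implicit Defensive.

Local Open Scope classical_set_scope.
Local Open Scope ring_scope.

(* Conventions. Vectors are row vectors, so linear maps act on the right:    *)
(* an endomorphism A sends u to u *m A, a covector is a column, and the       *)
(* differential of F at p sends u to u *m jacobian F p.                       *)
(* A tensor on a manifold is given by its components in every chart of the    *)
(* atlas, as functions of the coordinates; components outside the range of    *)
(* the chart are irrelevant. A tensor expression is defined on vector fields; *)
(* its value on vectors is obtained by extending them as constant (that is,   *)
(* coordinate) fields.                                                        *)

Section Calculus.
Variable R : realType.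

(* For open U: f is of class C^k on U. *)
Fixpoint Ck_on (V W : normedModType R) (k : nat) (U : set V) (f : V -> W) :
    Prop :=
  if k is k'.+1 then
    (forall x, U x -> differentiable f x) /\
    (forall v, Ck_on k' U (fun x => 'D_v f x))
  else forall x, U x -> {for x, continuous f}.

Definition smooth_on (V W : normedModType R) (U : set V) (f : V -> W) : Prop :=
  forall k, Ck_on k U f.

End Calculus.

(* Smooth manifolds without boundary, with a (not necessarily maximal) atlas  *)
(* indexed by [chart]; [chart_inv i] is the inverse of [chart_map i].         *)
Record manifold (R : realType) (d : nat) := Manifold {
  mpoint :> topologicalType;
  chart : Type;
  chart_dom : chart -> set mpoint;
  chart_map : chart -> mpoint -> 'rV[R]_d;
  chart_inv : chart -> 'rV[R]_d -> mpoint;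
  mfd_hausdorff : hausdorff_space mpoint;
  mfd_second_countable : @second_countable mpoint;
  mfd_cover : forall p, exists i, chart_dom i p;
  mfd_dom_open : forall i, open (chart_dom i);
  mfd_range_open : forall i, open (chart_map i @` chart_dom i);
  mfd_coordK : forall i p, chart_dom i p -> chart_inv i (chart_map i p) = p;
  mfd_coord_continuous :
    forall i, {within chart_dom i, continuous (chart_map i)};
  mfd_param_continuous :
    forall i, {within chart_map i @` chart_dom i, continuous (chart_inv i)};
  mfd_transition_smooth : forall i j,
    smooth_on (chart_map i @` (chart_dom i `&` chart_dom j))
      (chart_map j \o chart_inv i)
}.

Section Tensors.
Variables (R : realType) (d : nat) (N : manifold R d).

Definition crange (i : chart N) : set 'rV[R]_d := chart_map i @` chart_dom i.

Definition overlap (i j : chart N) : set 'rV[R]_d :=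
  chart_map i @` (chart_dom i `&` chart_dom j).

Definition transition (i j : chart N) : 'rV[R]_d -> 'rV[R]_d :=
  chart_map j \o chart_inv i.

(* Bilinear form of A at (u, v); covector w at u. *)
Definition bform (n : nat) (A : 'M[R]_n) (u v : 'rV[R]_n) : R :=
  (u *m A *m v^T) 0 0.

Definition cov_at (n : nat) (w : 'cV[R]_n) (u : 'rV[R]_n) : R := (u *m w) 0 0.

Definition vector_field (X : chart N -> 'rV[R]_d -> 'rV[R]_d) : Prop :=
  (forall i, smooth_on (crange i) (X i)) /\
  (forall i j y, overlap i j y ->
    X j (transition i j y) = X i y *m jacobian (transition i j) y).

Definition one_form (w : chart N -> 'rV[R]_d -> 'cV[R]_d) : Prop :=
  (forall i, smooth_on (crange i) (w i)) /\
  (forall i j y, overlap i j y ->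
    w i y = jacobian (transition i j) y *m w j (transition i j y)).

Definition endo_field (A : chart N -> 'rV[R]_d -> 'M[R]_d) : Prop :=
  (forall i, smooth_on (crange i) (A i)) /\
  (forall i j y, overlap i j y ->
    A i y *m jacobian (transition i j) y =
    jacobian (transition i j) y *m A j (transition i j y)).

Definition riemannian_metric (g : chart N -> 'rV[R]_d -> 'M[R]_d) : Prop :=
  [/\ forall i, smooth_on (crange i) (g i),
      forall i j y, overlap i j y ->
        g i y = jacobian (transition i j) y *m g j (transition i j y)
                  *m (jacobian (transition i j) y)^T,
      forall i y, crange i y -> (g i y)^T = g i y &
      forall i y u, crange i y -> u != 0 -> 0 < bform (g i y) u u].

End Tensors.

Section Local.
Variables (R : realType) (d : nat).
Implicit Types (X Y Z xi P : 'rV[R]_d -> 'rV[R]_d) (eta : 'rV[R]_d -> 'cV[R]_d).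
Implicit Types (G phi : 'rV[R]_d -> 'M[R]_d) (y u v w : 'rV[R]_d).
Implicit Types (Gam : 'rV[R]_d -> 'rV[R]_d -> 'rV[R]_d -> 'rV[R]_d).

Definition lie_bracket X Y y : 'rV[R]_d := 'D_(X y) Y y - 'D_(Y y) X y.

(* The normalisation with the factor 1/2, for which the contact condition     *)
(* Phi = d eta is compatible with nabla xi = - phi - phi h'.                  *)
Definition ext_deriv eta X Y y : R :=
  2^-1 * ('D_(X y) (fun z => cov_at (eta z) (Y z)) y
          - 'D_(Y y) (fun z => cov_at (eta z) (X z)) y
          - cov_at (eta y) (lie_bracket X Y y)).

Definition lie_endo xi phi X y : 'rV[R]_d :=
  lie_bracket xi (fun z => X z *m phi z) y - lie_bracket xi X y *m phi y.

Definition hprime xi phi y u : 'rV[R]_d := 2^-1 *: lie_endo xi phi (cst u) y.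

(* A linear connection in a chart is given by its coefficients                *)
(* Gam y u v = value at y of the derivative of the constant field v along u.  *)
Definition covderiv Gam X Y y : 'rV[R]_d := 'D_(X y) Y y + Gam y (X y) (Y y).

(* Koszul formula for the constant fields u, v and the coordinate fields. *)
Definition levi_civita G y u v : 'rV[R]_d :=
  (\row_k (2^-1 * ('D_u (fun z => bform (G z) v (delta_mx 0 k)) y
                   + 'D_v (fun z => bform (G z) u (delta_mx 0 k)) y
                   - 'D_(delta_mx 0 k) (fun z => bform (G z) u v) y)))
  *m invmx (G y).

Definition curvature (nab : ('rV[R]_d -> 'rV[R]_d) -> ('rV[R]_d -> 'rV[R]_d) ->
    'rV[R]_d -> 'rV[R]_d) X Y Z y : 'rV[R]_d :=
  nab X (nab Y Z) y - nab Y (nab X Z) y - nab (lie_bracket X Y) Z y.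

Definition riemann G y u v w : 'rV[R]_d :=
  curvature (covderiv (levi_civita G)) (cst u) (cst v) (cst w) y.

Definition sectional G y u v : R :=
  bform (G y) (riemann G y u v v) u /
  (bform (G y) u u * bform (G y) v v - bform (G y) u v ^+ 2).

Definition pi_form G P y u : R := bform (G y) (P y) u.

(* (nabla_X pi)(Y) *)
Definition nabla_pi G P X Y y : R :=
  'D_(X y) (fun z => pi_form G P z (Y z)) y
  - pi_form G P y (covderiv (levi_civita G) X Y y).

Definition alpha' G P y u v : R := nabla_pi G P (cst u) (cst v) y.

(* nabla_X Y + a pi(X) Y + b pi(Y) X *)
Definition tilde_conn G P (a b : R) y u v : 'rV[R]_d :=
  levi_civita G y u v + (a * pi_form G P y u) *: v + (b * pi_form G P y v) *: u.

Definition space_form_curvature G phi xi eta (kappa mu c : R) y u v w :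
    'rV[R]_d :=
  let g := bform (G y) in
  let et := cov_at (eta y) in
  let ph t := t *m phi y in
  let h := hprime xi phi y in
  let ph_h t := h t *m phi y in
  ((c + 3) / 4) *: (g v w *: u - g u w *: v)
  + ((c + 3 - 4 * kappa) / 4) *:
      ((et u * et w) *: v - (et v * et w) *: u
       + (g u w * et v) *: xi y - (g v w * et u) *: xi y)
  + ((c - 1) / 4) *:
      ((2 * g u (ph v)) *: ph w + g u (ph w) *: ph v - g v (ph w) *: ph u)
  + 2^-1 *:
      (g (h v) w *: h u - g (h u) w *: h v
       + g (ph_h u) w *: ph_h v - g (ph_h v) w *: ph_h u)
  - g u w *: h v + g v w *: h u
  + (et u * et w) *: h v - (et v * et w) *: h u
  - g (h u) w *: v + g (h v) w *: u
  - (g (h v) w * et u) *: xi y + (g (h u) w * et v) *: xi y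
  + mu *: ((et v * et w) *: h u - (et u * et w) *: h v
           + (g (h v) w * et u) *: xi y - (g (h u) w * et v) *: xi y).

End Local.

Section Contact.
Variables (R : realType) (d : nat) (N : manifold R d).
Variables (phi : chart N -> 'rV[R]_d -> 'M[R]_d).
Variables (xi : chart N -> 'rV[R]_d -> 'rV[R]_d).
Variables (eta : chart N -> 'rV[R]_d -> 'cV[R]_d).
Variables (g : chart N -> 'rV[R]_d -> 'M[R]_d).

Record almost_contact_metric : Prop := AlmostContactMetric {
  acm_metric : riemannian_metric g;
  acm_phi : endo_field phi;
  acm_xi : vector_field xi;
  acm_eta : one_form eta;
  acm_phi2 : forall i y u, crange i y ->
    u *m phi i y *m phi i y = - u + cov_at (eta i y) u *: xi i y;
  acm_eta_xi : forall i y, crange i y -> cov_at (eta i y) (xi i y) = 1;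
  acm_phi_xi : forall i y, crange i y -> xi i y *m phi i y = 0;
  acm_eta_phi : forall i y u, crange i y -> cov_at (eta i y) (u *m phi i y) = 0;
  acm_skew : forall i y u v, crange i y ->
    bform (g i y) u (v *m phi i y) = - bform (g i y) (u *m phi i y) v;
  acm_g_xi : forall i y u, crange i y ->
    bform (g i y) u (xi i y) = cov_at (eta i y) u
}.

Definition contact_metric : Prop :=
  almost_contact_metric /\
  forall i y u v, crange i y ->
    bform (g i y) u (v *m phi i y) = ext_deriv (eta i) (cst u) (cst v) y.

Definition kappa_mu_contact_metric (kappa mu : R) : Prop :=
  contact_metric /\
  forall i y u v, crange i y ->
    riemann (g i) y u v (xi i y) =
      kappa *: (cov_at (eta i y) v *: u - cov_at (eta i y) u *: v)
      + mu *: (cov_at (eta i y) v *: hprime (xi i) (phi i) y u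
               - cov_at (eta i y) u *: hprime (xi i) (phi i) y v).

Definition constant_phi_sectional (c : R) : Prop :=
  forall i y u, crange i y ->
    bform (g i y) u u = 1 -> bform (g i y) u (xi i y) = 0 ->
    sectional (g i) y u (u *m phi i y) = c.

(* The last clause follows from the other two by Koufogiorgos' theorem; as is *)
(* customary, the resulting expression of the curvature tensor is recorded    *)
(* together with the definition.                                              *)
Definition contact_space_form (kappa mu c : R) : Prop :=
  [/\ kappa_mu_contact_metric kappa mu,
      constant_phi_sectional c &
      forall i y u v w, crange i y ->
        riemann (g i) y u v w =
        space_form_curvature (g i) (phi i) (xi i) (eta i) kappa mu c y u v w].

End Contact.

Section Immersion.
Variables (R : realType) (n d : nat) (M : manifold R n) (N : manifold R d).

Definition local_expr (f : M -> N) (i : chart M) (j : chart N) :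
    'rV[R]_n -> 'rV[R]_d :=
  chart_map j \o f \o chart_inv i.

(* Immersed submanifolds; the metric of M is the induced one. *)
Definition immersion (f : M -> N) : Prop :=
  continuous f /\
  forall i j, let U := chart_map i @` (chart_dom i `&` f @^-1` chart_dom j) in
    smooth_on U (local_expr f i j) /\
    forall p, U p -> row_free (jacobian (local_expr f i j) p).

End Immersion.

(* Geometry of an immersion F : R^n -> R^d (a local expression) into a chart  *)
(* with metric G and a linear connection with coefficients Gam. Tangent       *)
(* vectors and tangent fields of the submanifold are written in the           *)
(* coordinates of the source; p is a point of the source.                     *)
Section Submanifold.
Variables (R : realType) (n d : nat).
Variables (G : 'rV[R]_d -> 'M[R]_d) (F : 'rV[R]_n -> 'rV[R]_d).
Variables (Gam : 'rV[R]_d -> 'rV[R]_d -> 'rV[R]_d -> 'rV[R]_d).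
Implicit Types (X Y : 'rV[R]_n -> 'rV[R]_n) (p u v w : 'rV[R]_n).
Implicit Types (Z : 'rV[R]_n -> 'rV[R]_d) (z : 'rV[R]_d).

Definition pushv p u : 'rV[R]_d := u *m jacobian F p.

Definition induced_metric p : 'M[R]_n :=
  jacobian F p *m G (F p) *m (jacobian F p)^T.

(* Orthogonal projection of an ambient vector at F p onto the tangent space,  *)
(* in source coordinates, and the complementary projection.                   *)
Definition tangential p z : 'rV[R]_n :=
  z *m G (F p) *m (jacobian F p)^T *m invmx (induced_metric p).

Definition normal_part p z : 'rV[R]_d := z - pushv p (tangential p z).

(* Derivative, for the ambient connection, of a vector field Z along F in the *)
(* direction X; it is the derivative along X of any local extension of Z.     *)
Definition cov_along X Z p : 'rV[R]_d :=
  'D_(X p) Z p + Gam (F p) (pushv p (X p)) (Z p).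

Definition induced_conn X Y p : 'rV[R]_n :=
  tangential p (cov_along X (fun q => pushv q (Y q)) p).

Definition second_form X Y p : 'rV[R]_d :=
  normal_part p (cov_along X (fun q => pushv q (Y q)) p).

Definition Rsub p u v w t : R :=
  bform (induced_metric p)
    (curvature induced_conn (cst u) (cst v) (cst w) p) t.

(* for g-orthonormal u, v *)
Definition Ksub p u v : R := 2^-1 * (Rsub p u v v u - Rsub p u v u v).

Definition orthonormal_basis p (e : 'I_n -> 'rV[R]_n) : Prop :=
  forall i j, bform (induced_metric p) (e i) (e j) = (i == j)%:R.

Definition mean_curvature p (e : 'I_n -> 'rV[R]_n) : 'rV[R]_d :=
  n%:R^-1 *: \sum_i second_form (cst (e i)) (cst (e i)) p.

(* e 0, ..., e (k-1) is an orthonormal frame of the row space of L with first *)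
(* vector u.                                                                  *)
Definition frame_of p (k : nat) (L : 'M[R]_n) u (e : nat -> 'rV[R]_n) : Prop :=
  [/\ forall i j, (i < k)%N -> (j < k)%N ->
        bform (induced_metric p) (e i) (e j) = (i == j)%:R,
      forall i, (i < k)%N -> (e i <= L)%MS &
      e 0%N = u].

Definition ricL p (k : nat) (e : nat -> 'rV[R]_n) : R :=
  \sum_(1 <= j < k) Ksub p (e 0%N) (e j).

(* The set below is nonempty and bounded below, so [inf] is its infimum. *)
Definition Theta p (k : nat) : R :=
  (k.-1)%:R^-1 *
  inf [set r | exists (L : 'M[R]_n) (u : 'rV[R]_n) (e : nat -> 'rV[R]_n),
        [/\ \rank L = k, (u <= L)%MS, bform (induced_metric p) u u = 1,
            frame_of p k L u e & r = ricL p k e]].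

(* tangential part of an endomorphism A of the ambient tangent space at F p *)
Definition tan_endo p (A : 'rV[R]_d -> 'rV[R]_d) u : 'rV[R]_n :=
  tangential p (A (pushv p u)).

Definition endo_norm2 p (e : 'I_n -> 'rV[R]_n) (A : 'rV[R]_n -> 'rV[R]_n) : R :=
  \sum_i \sum_j bform (induced_metric p) (e i) (A (e j)) ^+ 2.

Definition endo_trace p (e : 'I_n -> 'rV[R]_n) (A : 'rV[R]_n -> 'rV[R]_n) : R :=
  \sum_i bform (induced_metric p) (e i) (A (e i)).

End Submanifold.

(* Main.v *)
From HB Require Import structures.
Require Import Defs.
From mathcomp Require Import all_boot all_order all_algebra.
From mathcomp Require Import all_classical all_reals all_analysis.
From mathcomp Require Import ring lra zify.
Import Order.TTheory GRing.Theory Num.Theory.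
Import numFieldNormedType.Exports.

(* The Gauss equation, applied to the ambient connection and to the space     *)
(* form curvature, expresses the sectional curvatures of the induced          *)
(* connection through the second fundamental form and bilinear forms on the   *)
(* tangent space. Summing over an orthonormal frame gives                     *)
(*   sum K(e_i, e_j) = (terms of the statement) + n^2 |H|^2 - sum |h_ij|^2,   *)
(* where sum |h_ij|^2 >= n |H|^2 by Cauchy-Schwarz. On the other side, the    *)
(* frames (e_i, e_l, e_{l+1}, ..., e_{l+k-2}), with indices different from i  *)
(* taken cyclically, use every pair (i, j) the same number k - 1 of times, so *)
(* averaging the k-Ricci curvatures yields sum K(e_i, e_j) >= n(n-1) Theta_k. *)
(* The symmetry of h' and phi h' is not a hypothesis: it comes from           *)
(* L_xi eta = 0 and L_xi (d eta) = 0.                                         *)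

Set Implicit Arguments.
Unset Strict Implicit.
Unset Printing Implicit Defensive.

Local Open Scope classical_set_scope.
Local Open Scope ring_scope.

(** All estimates take place at one point, in one chart of each manifold, and rest on four facts.

    Gauss equation. [tilde_curvature] writes the curvature of the modified connection as the
    Levi-Civita curvature plus terms in [alpha'] and pi. Covariant derivatives along the immersion
    commute up to this ambient curvature ([cov_commutator]). The tangential derivative of a normal
    field N obeys a Weingarten formula ([normal_field_derive]) with an extra term b pi(N), because
    the connection is not metric; this term is the source of pi(H) in the bound. Together they give
    [gauss_equation].

    Symmetry of h' and phi h'. The form d eta is closed and xi lies in its kernel, so its Lie
    derivative along xi vanishes. Since d eta is built from phi and g, this reads (L_xi phi) g = -
    phi (L_xi g), and the symmetry of L_xi g passes to phi h' ([phi_hprime_sym]). As h' anticommutes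
    with phi, it passes to h' as well ([hprime_sym]).

    Trace. After the space form curvature is inserted, the curvature of the submanifold is a
    polynomial [curvature_form] in bilinear forms on the tangent space. [sum_sectional_form] sums it
    over the pairs of an orthonormal basis. The constant a disappears, because its term carries the
    product of two orthogonal vectors, and the second fundamental form contributes n^2 |H|^2 minus
    its squared norm, which is at most n(n-1) |H|^2.

    Averaging. Each k-Ricci curvature is at least (k-1) Theta_k. Averaging over cyclic families of
    frames ([Theta_le]) bounds n(n-1) Theta_k by the same trace, and [mean_curvature_bound] combines
    the two. *)

(** * Directional derivatives and differentiability of matrix-valued maps *)

Section DirectionalCalculus.
Variables (R : realType) (V : normedModType R).
Implicit Types (x u v : V).

(** The difference g - f vanishes near x, so its differential at x is zero. This allows a map to be
    replaced by a formula valid only on an open set, such as the range of a chart. *)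
Lemma near_eq_differentiable (W : normedModType R) (f g : V -> W) x :
  (\forall z \near x, f z = g z) -> differentiable f x -> differentiable g x.
Proof.
move=> fg df; pose k := g - f.
have k0 : \forall z \near x, k z = 0.
  by apply: filterS fg => z fgz; rewrite /k /= !fctE fgz subrr.
have kx : k x = 0 by exact: (nbhs_singleton k0).
have kE : k \o shift x = cst (k x) + (\0 : {linear V -> W}) +o_ (0:V) id.
  apply/eqaddoP => e e0.
  have : \forall z \near 0, k (z + x) = 0.
    by move: k0; rewrite (near_shift 0) subr0.
  apply: filterS => z /= kz; rewrite !fctE /= kz kx !addr0 subrr normr0.
  by rewrite mulr_ge0 // ltW.
have dk : differentiable k x.
  have d0 : 'd k x = (\0 : {linear V -> W}) :> (V -> W).
    by apply: diff_unique kE => z; exact: cvg_cst.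
  apply/diff_locallyP; split; rewrite d0; last exact: kE.
  by move=> z; exact: cvg_cst.
have -> : g = k + f by apply/funext => z; rewrite /k !fctE subrK.
exact: differentiableD.
Qed.

Lemma deriveDl (W : normedModType R) (f : V -> W) x u v : differentiable f x ->
  'D_(u + v) f x = 'D_u f x + 'D_v f x.
Proof. by move=> df; rewrite !deriveE // linearD. Qed.

Lemma deriveZdir (W : normedModType R) (f : V -> W) x (a : R) u : differentiable f x ->
  'D_(a *: u) f x = a *: 'D_u f x.
Proof. by move=> df; rewrite !deriveE // linearZ. Qed.

Lemma derive_chain (W W' : normedModType R) (F : V -> W) (f : W -> W') x u :
  differentiable F x -> differentiable f (F x) ->
  'D_u (fun z => f (F z)) x = 'D_('D_u F x) f (F x).
Proof.
move=> dF df; rewrite deriveE; last exact: differentiable_comp.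
by rewrite (diff_comp dF df) /= [in RHS]deriveE // [in RHS]deriveE.
Qed.

Lemma differentiable_bigsum (W : normedModType R) (I : Type) (r : seq I) (P : pred I)
  (f : I -> V -> W) x :
  (forall i, P i -> differentiable (f i) x) ->
  differentiable (fun z => \sum_(i <- r | P i) f i z) x.
Proof.
move=> df; have -> : (fun z => \sum_(i <- r | P i) f i z) = \sum_(i <- r | P i) f i.
  by apply/funext => z; rewrite fct_sumE.
by elim/big_ind : _ => [|g h dg dh|//]; [exact: differentiable_cst|exact: differentiableD].
Qed.

Lemma differentiable_bigprod (I : Type) (r : seq I) (P : pred I)
  (f : I -> V -> R) x :
  (forall i, P i -> differentiable (f i) x) ->
  differentiable (fun z => \prod_(i <- r | P i) f i z) x.
Proof.
move=> df; elim: r => [|i r IH].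
  by under eq_fun do rewrite big_nil; exact: differentiable_cst.
under eq_fun do rewrite big_cons; case Pi: (P i) => //.
by apply: differentiableM => //; exact: df.
Qed.

Lemma derive_bigsum (W : normedModType R) (I : Type) (r : seq I) (P : pred I)
  (f : I -> V -> W) x u :
  (forall i, P i -> differentiable (f i) x) ->
  'D_u (fun z => \sum_(i <- r | P i) f i z) x = \sum_(i <- r | P i) 'D_u (f i) x.
Proof.
move=> df; elim: r => [|i r IH].
  by under eq_fun do rewrite big_nil; rewrite big_nil derive_cst.
under eq_fun do rewrite big_cons; rewrite big_cons; case Pi: (P i) => //.
rewrite -IH -deriveD //; first by apply: diff_derivable; exact: df.
by apply: diff_derivable; exact: differentiable_bigsum.
Qed.

Lemma differentiable_mxE m n (A : V -> 'M[R]_(m, n)) x i j :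
  differentiable A x -> differentiable (fun z => A z i j) x.
Proof.
move=> dA; apply: (differentiable_comp (g := fun M : 'M[R]_(m, n) => M i j : R)) => //.
exact: differentiable_coord.
Qed.

Lemma differentiable_mx m n (A : V -> 'M[R]_(m, n)) x :
  (forall i j, differentiable (fun z => A z i j) x) -> differentiable A x.
Proof.
move=> dA.
have -> : A = fun z => \sum_i \sum_j A z i j *: delta_mx i j.
  by apply/funext => z; exact: matrix_sum_delta.
apply: differentiable_bigsum => i _; apply: differentiable_bigsum => j _.
exact: differentiableZl.
Qed.

Lemma derive_mxE m n (A : V -> 'M[R]_(m, n)) x u i j : differentiable A x ->
  ('D_u A x) i j = 'D_u (fun z => A z i j) x.
Proof. by move=> dA; rewrite derive_mx ?mxE //; exact: diff_derivable. Qed.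

Lemma differentiable_mulmx m n q (A : V -> 'M[R]_(m, n)) (B : V -> 'M[R]_(n, q)) x :
  differentiable A x -> differentiable B x ->
  differentiable (fun z => A z *m B z) x.
Proof.
move=> dA dB; apply: differentiable_mx => i j.
under eq_fun do rewrite mxE; apply: differentiable_bigsum => k _.
by apply: differentiableM; exact: differentiable_mxE.
Qed.

Lemma derive_mulmx m n q (A : V -> 'M[R]_(m, n)) (B : V -> 'M[R]_(n, q)) x u :
  differentiable A x -> differentiable B x ->
  'D_u (fun z => A z *m B z) x = 'D_u A x *m B x + A x *m 'D_u B x.
Proof.
move=> dA dB; apply/matrixP => i j.
rewrite derive_mxE; last exact: differentiable_mulmx.
under eq_fun do rewrite mxE.
have dm k : differentiable (fun z => A z i k * B z k j) x.
  by apply: differentiableM; exact: differentiable_mxE.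
rewrite derive_bigsum // !mxE -big_split /=; apply: eq_bigr => k _.
rewrite !derive_mxE // deriveM /=; try by apply: diff_derivable; exact: differentiable_mxE.
by rewrite [RHS]addrC [X in _ = _ + X]mulrC.
Qed.

Lemma differentiable_trmx m n (A : V -> 'M[R]_(m, n)) x :
  differentiable A x -> differentiable (fun z => (A z)^T) x.
Proof.
move=> dA; apply: differentiable_mx => i j.
by under eq_fun do rewrite mxE; exact: differentiable_mxE.
Qed.

Lemma derive_trmx m n (A : V -> 'M[R]_(m, n)) x u : differentiable A x ->
  'D_u (fun z => (A z)^T) x = ('D_u A x)^T.
Proof.
move=> dA; apply/matrixP => i j.
rewrite derive_mxE ?mxE ?derive_mxE //; last exact: differentiable_trmx.
by under eq_fun do rewrite mxE.
Qed.

Lemma differentiable_det n (A : V -> 'M[R]_n) x :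
  differentiable A x -> differentiable (fun z => \det (A z)) x.
Proof.
move=> dA; rewrite /determinant; apply: differentiable_bigsum => s _.
apply: differentiableM; first exact: differentiable_cst.
by apply: differentiable_bigprod => i _; exact: differentiable_mxE.
Qed.

(** Cramer's formula: near x the inverse is the adjugate divided by the determinant, both polynomial
    in the entries. *)
Lemma differentiable_invmx n (A : V -> 'M[R]_n) x :
  (\forall z \near x, A z \in unitmx) -> differentiable A x ->
  differentiable (fun z => invmx (A z)) x.
Proof.
move=> uA dA; apply: (@near_eq_differentiable _ (fun z => (\det (A z))^-1 *: \adj (A z))).
  by apply: filterS uA => z; rewrite /invmx => ->.
apply: differentiable_mx => i j.
under eq_fun do rewrite !mxE /cofactor.
apply: differentiableM; last first.
  apply: differentiableM; first exact: differentiable_cst.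
  apply: differentiable_det; apply: differentiable_mx => k l.
  by under eq_fun do rewrite !mxE; exact: differentiable_mxE.
apply: differentiableV; first exact: differentiable_det.
by have := nbhs_singleton uA; rewrite unitmxE unitfE.
Qed.

End DirectionalCalculus.

(** * Symmetry of second directional derivatives *)

Section Schwarz.
Variables (R : realType) (V : normedModType R).
Implicit Types (x z u v : V).

Lemma directional_MVT (f : V -> R) z u (h : R) : 0 <= h ->
  (forall s, 0 <= s <= h -> differentiable f (z + s *: u)) ->
  exists2 s, 0 <= s <= h & f (z + h *: u) - f z = h * 'D_u f (z + s *: u).
Proof.
move=> h0 df; pose F (s : R) := z + s *: u.
have dF s : differentiable F s.
  rewrite /F; apply: differentiableD; first exact: differentiable_cst.
  by apply: (differentiableZl u); exact: ex_diff.
have DF s : 'D_1 F s = u.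
  rewrite /F deriveD //; first last.
    by apply: diff_derivable; apply: (differentiableZl u); exact: ex_diff.
  rewrite derive_cst add0r deriveE; last by apply: (differentiableZl u); exact: ex_diff.
  by rewrite diffZl ?diff_val ?scale1r //; exact: ex_diff.
have dfF s : 0 <= s <= h -> differentiable (fun s => f (F s)) s.
  by move=> /df dfs; exact: differentiable_comp.
have [] := @MVT_segment R (fun s => f (F s)) (fun s => 'D_u f (F s)) 0 h h0.
- move=> s; rewrite in_itv /= => /andP[/ltW s0 /ltW sh].
  have sI : 0 <= s <= h by rewrite s0 sh.
  rewrite -[X in 'D_X f _](DF s) -derive_chain //; last exact: df.
  by apply: derivableP; apply: diff_derivable; exact: dfF.
- apply: continuous_in_subspaceT => s; rewrite inE /= in_itv /= => sI.
  by apply: differentiable_continuous; exact: dfF.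
- move=> s; rewrite in_itv /= => sI; rewrite /F scale0r addr0 subr0 mulrC => fE.
  by exists s.
Qed.

(** The mean value theorem is used twice: along u for the increment y |-> f(y + h v) - f(y), then
    along v for the derivative of f in direction u. *)
Lemma second_difference (f : V -> R) x u v (h : R) : 0 <= h ->
  (forall s t, 0 <= s <= h -> 0 <= t <= h ->
     differentiable f (x + s *: u + t *: v) /\
     differentiable ('D_u f) (x + s *: u + t *: v)) ->
  exists s t, [/\ 0 <= s <= h, 0 <= t <= h &
    f (x + h *: u + h *: v) - f (x + h *: u) - f (x + h *: v) + f x =
    h * h * 'D_v ('D_u f) (x + s *: u + t *: v)].
Proof.
move=> h0 df.
have hI : 0 <= h <= h by rewrite h0 lexx.
have zI : 0 <= (0 : R) <= h by rewrite lexx.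
have dshift w z : differentiable f (z + w) -> differentiable (fun y => f (y + w)) z.
  move=> dfz; apply: (differentiable_comp (f := fun y => y + w)) => //.
have Dshift w z : differentiable f (z + w) -> 'D_u (fun y => f (y + w)) z = 'D_u f (z + w).
  move=> dfz; have dw : differentiable (fun y : V => y + w) z.
    by apply: differentiableD; [exact: ex_diff|exact: differentiable_cst].
  rewrite (derive_chain (F := fun y => y + w)) //; congr ('D_ _ f _).
  rewrite deriveD ?derive_id ?derive_cst ?addr0 //.
pose k y := f (y + h *: v) - f y.
have dk s : 0 <= s <= h -> differentiable (fun y => f (y + h *: v)) (x + s *: u) /\
    differentiable f (x + s *: u).
  move=> sI; split; first by apply: dshift; have [] := df s h sI hI.
  by have [] := df s 0 sI zI; rewrite scale0r addr0.
have [s sI kE] := @directional_MVT k x u h h0 (fun s sI => differentiableB (dk s sI).1 (dk s sI).2).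
have {kE} : k (x + h *: u) - k x = h * ('D_u f (x + s *: u + h *: v) - 'D_u f (x + s *: u)).
  rewrite kE deriveB; try by apply: diff_derivable; case: (dk s sI).
  by rewrite Dshift //; have [] := df s h sI hI.
have [t tI ->] := @directional_MVT ('D_u f) (x + s *: u) v h h0 (fun t tI => (df s t sI tI).2).
rewrite mulrA => kE; exists s, t; split => //; rewrite -kE /k; ring.
Qed.

Lemma dist_le_half (a b c e : R) : `|a - c| < e / 2 -> `|b - c| < e / 2 -> `|a - b| <= e.
Proof. by move=> /ltr_normlP[? ?] /ltr_normlP[? ?]; apply/ler_normlP; split; lra. Qed.

(** The second difference is symmetric in u and v, so the two mixed derivatives take a common value
    at two points close to x; continuity at x then forces them to agree there. *)
Lemma derive_comm_real (f : V -> R) x u v :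
  (\forall z \near x, [/\ differentiable f z, differentiable ('D_u f) z &
                          differentiable ('D_v f) z]) ->
  {for x, continuous ('D_v ('D_u f))} -> {for x, continuous ('D_u ('D_v f))} ->
  'D_v ('D_u f) x = 'D_u ('D_v f) x.
Proof.
move=> /nbhs_ballP[d1 /= d10 B1] cvu cuv.
apply/eqP; rewrite -subr_eq0 -normr_le0; apply/ler_addgt0Pl => e e0; rewrite addr0.
have e2 : 0 < e / 2 by rewrite divr_gt0.
have /nbhs_ballP[d2 /= d20 B2] : \forall z \near x, `|'D_v ('D_u f) x - 'D_v ('D_u f) z| < e / 2.
  exact: ((cvgrPdist_lt _ _).1 cvu _ e2).
have /nbhs_ballP[d3 /= d30 B3] : \forall z \near x, `|'D_u ('D_v f) x - 'D_u ('D_v f) z| < e / 2.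
  exact: ((cvgrPdist_lt _ _).1 cuv _ e2).
pose d := Num.min d1 (Num.min d2 d3).
have d0 : 0 < d by rewrite !lt_min d10 d20 d30.
(* This h keeps the parallelogram with sides h u and h v inside the ball of radius d; the summand 1
   covers the case u = v = 0. *)
pose h := d / (2 * (`|u| + `|v| + 1)).
have c0 : 0 < 2 * (`|u| + `|v| + 1) by rewrite mulr_gt0 // ltr_wpDl // addr_ge0.
have h0 : 0 < h by rewrite divr_gt0.
have hd : h * (`|u| + `|v|) < d.
  rewrite /h mulrAC ltr_pdivrMr // ltr_pM2l //.
  by have := normr_ge0 u; have := normr_ge0 v; lra.
have inB s t : 0 <= s <= h -> 0 <= t <= h -> ball x d (x + s *: u + t *: v).
  move=> /andP[s0 sh] /andP[t0 th]; rewrite -ball_normE /= -addrA opprD addNKr normrN.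
  rewrite (le_lt_trans (ler_normD _ _)) // (le_lt_trans _ hd) // !normrZ !ger0_norm // mulrDr.
  by apply: lerD; exact: ler_wpM2r.
have le1 : d <= d1 by rewrite ge_min lexx.
have le2 : d <= d2 by rewrite !ge_min lexx orbT.
have le3 : d <= d3 by rewrite !ge_min lexx !orbT.
have [s [t [sI tI E1]]] : exists s t, [/\ 0 <= s <= h, 0 <= t <= h &
    f (x + h *: u + h *: v) - f (x + h *: u) - f (x + h *: v) + f x =
    h * h * 'D_v ('D_u f) (x + s *: u + t *: v)].
  apply: second_difference; first exact: ltW.
  by move=> s t sI tI; have [] := B1 _ (le_ball le1 (inB s t sI tI)).
have [t' [s' [tI' sI' E2]]] : exists t s, [/\ 0 <= t <= h, 0 <= s <= h &
    f (x + h *: v + h *: u) - f (x + h *: v) - f (x + h *: u) + f x =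
    h * h * 'D_u ('D_v f) (x + t *: v + s *: u)].
  apply: second_difference; first exact: ltW.
  move=> t' s' tI' sI'; rewrite addrAC.
  by have [] := B1 _ (le_ball le1 (inB s' t' sI' tI')).
have E : 'D_v ('D_u f) (x + s *: u + t *: v) = 'D_u ('D_v f) (x + s' *: u + t' *: v).
  have hh : h * h != 0 by rewrite mulf_neq0 // gt_eqF.
  rewrite [x + h *: v + h *: u]addrAC [x + t' *: v + s' *: u]addrAC in E2.
  have swap (p q r w : R) : p - q - r + w = p - r - q + w by rewrite (addrAC p).
  apply: (mulfI hh); apply: etrans (esym E1) _; apply: etrans E2; exact: swap.
have n1 : `|'D_v ('D_u f) x - 'D_v ('D_u f) (x + s *: u + t *: v)| < e / 2.
  exact: B2 _ (le_ball le2 (inB s t sI tI)).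
have n2 : `|'D_u ('D_v f) x - 'D_u ('D_v f) (x + s' *: u + t' *: v)| < e / 2.
  exact: B3 _ (le_ball le3 (inB s' t' sI' tI')).
by rewrite E in n1; exact: dist_le_half n1 n2.
Qed.

(** Reduction to entries. An entry of a derivative is the derivative of the entry only where the map
    is differentiable, so every identity and every hypothesis is carried over on a neighbourhood of
    x. *)
Lemma derive_comm m n (f : V -> 'M[R]_(m, n)) x u v :
  (\forall z \near x, [/\ differentiable f z, differentiable ('D_u f) z &
                          differentiable ('D_v f) z]) ->
  {for x, continuous ('D_v ('D_u f))} -> {for x, continuous ('D_u ('D_v f))} ->
  'D_v ('D_u f) x = 'D_u ('D_v f) x.
Proof.
move=> df cvu cuv; apply/matrixP => i j.
have [d0 du dv] := nbhs_singleton df.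
pose g z := f z i j.
have dg w : \forall z \near x, 'D_w f z i j = 'D_w g z.
  by apply: filterS df => z [dz _ _]; exact: derive_mxE.
have dgn w w' : \forall z \near x, differentiable ('D_w f) z -> 
    'D_w' ('D_w f) z i j = 'D_w' ('D_w g) z.
  have := near_join (dg w); apply: filterS => z nz dz.
  by rewrite derive_mxE //; exact: near_eq_derive.
have dgD w : \forall z \near x, differentiable ('D_w f) z -> differentiable ('D_w g) z.
  have := near_join (dg w); apply: filterS => z nz dz.
  by apply: near_eq_differentiable nz _; exact: differentiable_mxE.
have Dg w w' : differentiable ('D_w f) x -> 'D_w' ('D_w f) x i j = 'D_w' ('D_w g) x.
  exact: (nbhs_singleton (dgn w w')).
have Cg w w' : (\forall z \near x, differentiable ('D_w f) z) -> {for x, continuous ('D_w' ('D_w f))} ->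
    {for x, continuous ('D_w' ('D_w g))}.
  move=> dw c.
  have L : (fun z => 'D_w' ('D_w f) z i j) @ x --> 'D_w' ('D_w f) x i j.
    exact: (continuous_comp c (@coord_continuous _ _ _ i j _)).
  have {}L : (fun z => 'D_w' ('D_w f) z i j) @ x --> 'D_w' ('D_w g) x.
    exact: (eq_ind _ (fun l : R => _ @ x --> l) L _ (Dg w w' (nbhs_singleton dw))).
  apply: cvg_trans L; apply: near_eq_cvg.
  by apply: filterS2 dw (dgn w w') => z dz fg; rewrite fg.
suff gC : 'D_v ('D_u g) x = 'D_u ('D_v g) x.
  exact: etrans (Dg u v du) (etrans gC (esym (Dg v u dv))).
apply: derive_comm_real.
- apply: filterS3 df (dgD u) (dgD v) => z [dz duz dvz] gu gv.
  by split; [exact: differentiable_mxE|exact: gu|exact: gv].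
- by apply: Cg => //; apply: filterS df => z [].
- by apply: Cg => //; apply: filterS df => z [].
Qed.

End Schwarz.

(** * Smooth maps on open sets, and derivatives of bilinear forms *)

Section Smooth.
Variables (R : realType) (V : normedModType R).
Implicit Types (x u v : V) (U : set V).

Lemma smooth_on_derive (W : normedModType R) U (f : V -> W) v :
  smooth_on U f -> smooth_on U ('D_v f).
Proof. by move=> sf k; exact: (sf k.+1).2. Qed.

Lemma smooth_on_differentiable (W : normedModType R) U (f : V -> W) x :
  smooth_on U f -> U x -> differentiable f x.
Proof. by move=> sf; exact: (sf 1).1. Qed.

Lemma smooth_on_derive_comm m n U (f : V -> 'M[R]_(m, n)) x u v :
  open U -> smooth_on U f -> U x -> 'D_v ('D_u f) x = 'D_u ('D_v f) x.
Proof.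
move=> oU sf Ux; have sD w w' : smooth_on U ('D_w ('D_w' f)).
  by do 2 apply: smooth_on_derive.
apply: derive_comm; [|exact: (sD v u 0)|exact: (sD u v 0)].
apply: filterS (open_nbhs_nbhs (conj oU Ux)) => z Uz.
split; [|apply: (@smooth_on_differentiable _ U)..] => //.
- exact: smooth_on_differentiable Uz.
- exact: smooth_on_derive.
- exact: smooth_on_derive.
Qed.

End Smooth.

Section MatrixDerivatives.
Variables (R : realType) (V : normedModType R).
Implicit Types (x u : V).

Lemma derive_mulmxl m n q (A : V -> 'M[R]_(m, n)) (B : 'M[R]_(n, q)) x u :
  differentiable A x -> 'D_u (fun z => A z *m B) x = 'D_u A x *m B.
Proof.
by move=> dA; rewrite (derive_mulmx u dA (differentiable_cst B x)) derive_cst mulmx0 addr0.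
Qed.

Lemma derive_mulmxr m n q (A : 'M[R]_(m, n)) (B : V -> 'M[R]_(n, q)) x u :
  differentiable B x -> 'D_u (fun z => A *m B z) x = A *m 'D_u B x.
Proof.
by move=> dB; rewrite (derive_mulmx u (differentiable_cst A x) dB) derive_cst mul0mx add0r.
Qed.

Lemma differentiable_bform n (A : V -> 'M[R]_n) (X Y : V -> 'rV[R]_n) x :
  differentiable A x -> differentiable X x -> differentiable Y x ->
  differentiable (fun z => bform (A z) (X z) (Y z)) x.
Proof.
move=> dA dX dY; apply: differentiable_mxE; apply: differentiable_mulmx.
  exact: differentiable_mulmx.
exact: differentiable_trmx.
Qed.

Lemma derive_bform n (A : V -> 'M[R]_n) (X Y : V -> 'rV[R]_n) x u :
  differentiable A x -> differentiable X x -> differentiable Y x ->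
  'D_u (fun z => bform (A z) (X z) (Y z)) x =
  bform ('D_u A x) (X x) (Y x) + bform (A x) ('D_u X x) (Y x)
    + bform (A x) (X x) ('D_u Y x).
Proof.
move=> dA dX dY; have dXA := differentiable_mulmx dX dA.
have dYt := differentiable_trmx dY.
rewrite -derive_mxE; last exact: differentiable_mulmx.
rewrite derive_mulmx // derive_mulmx // derive_trmx //.
have addmxE p q (B C : 'M[R]_(p, q)) i j : (B + C) i j = B i j + C i j by rewrite mxE.
by rewrite mulmxDl !addmxE [X in X + _ = _]addrC.
Qed.

End MatrixDerivatives.

Section Bform.
Variables (R : realType) (n : nat).
Implicit Types (A : 'M[R]_n) (u v w : 'rV[R]_n).

Lemma bformDl A u v w : bform A (u + v) w = bform A u w + bform A v w.
Proof. by rewrite /bform !mulmxDl mxE. Qed.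

Lemma bformDr A u v w : bform A w (u + v) = bform A w u + bform A w v.
Proof. by rewrite /bform linearD /= mulmxDr mxE. Qed.

Lemma bformZl A a u w : bform A (a *: u) w = a * bform A u w.
Proof. by rewrite /bform -!scalemxAl mxE. Qed.

Lemma bformZr A a u w : bform A w (a *: u) = a * bform A w u.
Proof. by rewrite /bform linearZ /= -scalemxAr mxE. Qed.

Lemma bformNl A u w : bform A (- u) w = - bform A u w.
Proof. by rewrite -scaleN1r bformZl mulN1r. Qed.

Lemma bformNr A u w : bform A w (- u) = - bform A w u.
Proof. by rewrite -scaleN1r bformZr mulN1r. Qed.

Lemma bform0l A w : bform A 0 w = 0.
Proof. by rewrite /bform !mul0mx mxE. Qed.

Lemma bform0r A w : bform A w 0 = 0.
Proof. by rewrite /bform trmx0 mulmx0 mxE. Qed.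

Lemma bform_suml A (I : Type) (r : seq I) (P : pred I) (f : I -> 'rV[R]_n) w :
  bform A (\sum_(i <- r | P i) f i) w = \sum_(i <- r | P i) bform A (f i) w.
Proof. by apply: (big_morph _ (fun u v => bformDl A u v w) (bform0l A w)). Qed.

Lemma bform_sumr A (I : Type) (r : seq I) (P : pred I) (f : I -> 'rV[R]_n) w :
  bform A w (\sum_(i <- r | P i) f i) = \sum_(i <- r | P i) bform A w (f i).
Proof. by apply: (big_morph _ (fun u v => bformDr A u v w) (bform0r A w)). Qed.

Lemma bform_sym A u v : A^T = A -> bform A u v = bform A v u.
Proof.
move=> sA; rewrite /bform.
have -> : (u *m A *m v^T) 0 0 = (u *m A *m v^T)^T 0 0 by rewrite [RHS]mxE.
by rewrite !trmx_mul trmxK sA mulmxA.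
Qed.

Lemma bformDm A B u v : bform (A + B) u v = bform A u v + bform B u v.
Proof. by rewrite /bform mulmxDr mulmxDl mxE. Qed.

Lemma mx_eq_bform A B : (forall u v, bform A u v = bform B u v) -> A = B.
Proof.
move=> AB; apply/matrixP => i j; have := AB (delta_mx 0 i) (delta_mx 0 j).
by rewrite /bform !trmx_delta -!rowE -!colE !mxE.
Qed.

(** A nonzero vector in the kernel would have square norm zero. *)
Lemma posdef_unitmx A : (forall u, u != 0 -> 0 < bform A u u) -> A \in unitmx.
Proof.
move=> pA; rewrite -row_free_unit -kermx_eq0; apply: contraT => /rowV0Pn[u].
move=> /sub_kermxP uA /pA; by rewrite /bform uA mul0mx mxE ltxx.
Qed.

End Bform.

(** * The Levi-Civita connection from the Koszul formula *)

Section LeviCivita.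
Variables (R : realType) (d : nat) (G : 'rV[R]_d -> 'M[R]_d).
Implicit Types (y z u v w : 'rV[R]_d).

Lemma derive_bform_cst y u v w : differentiable G y ->
  'D_u (fun z => bform (G z) v w) y = bform ('D_u G y) v w.
Proof.
move=> dG; rewrite (derive_bform u dG (differentiable_cst v y) (differentiable_cst w y)).
by rewrite !derive_cst bform0l bform0r !addr0.
Qed.

Lemma derive_tr_sym y u : (\forall z \near y, (G z)^T = G z) -> differentiable G y ->
  ('D_u G y)^T = 'D_u G y.
Proof. by move=> sG dG; rewrite -derive_trmx //; exact: near_eq_derive. Qed.

(* Both sides of the Koszul formula are linear in the last argument, so it    *)
(* suffices to know it on the coordinate fields.                              *)
Lemma koszul_row (D : {linear 'rV[R]_d -> 'M[R]_d}) u v w :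
  ((\row_k (2^-1 * (bform (D u) v (delta_mx 0 k) + bform (D v) u (delta_mx 0 k)
     - bform (D (delta_mx 0 k)) u v))) *m w^T) 0 0 =
  2^-1 * (bform (D u) v w + bform (D v) u w - bform (D w) u v).
Proof.
rewrite mxE [in RHS](row_sum_delta w) !bform_sumr linear_sum.
have -> : bform (\sum_j D (w 0 j *: delta_mx 0 j)) u v =
   \sum_j w 0 j * bform (D (delta_mx 0 j)) u v.
  rewrite /bform mulmx_sumr mulmx_suml summxE; apply: eq_bigr => j _.
  by rewrite linearZ -scalemxAr -scalemxAl mxE.
rewrite -!big_split -sumrB mulr_sumr; apply: eq_bigr => k _.
rewrite !mxE !bformZr /=; move: (bform _ _ _) (bform _ _ _) (bform _ _ _) => p q r; ring.
Qed.

(** [D] stands for the differential of the metric at y; having it as a linear map gives linearity in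
    the direction, which the raw directional derivative does not provide. *)
Lemma levi_civita_koszul (D : {linear 'rV[R]_d -> 'M[R]_d}) y u v w :
  differentiable G y -> G y \in unitmx -> (forall t, 'D_t G y = D t) ->
  bform (G y) (levi_civita G y u v) w =
  2^-1 * (bform (D u) v w + bform (D v) u w - bform (D w) u v).
Proof.
move=> dG uG DE; rewrite /levi_civita [LHS]/bform mulmxKV //.
rewrite -koszul_row; congr ((_ *m _) _ _).
by apply/rowP => k; rewrite 2!mxE !derive_bform_cst // !DE.
Qed.

Lemma bform_inj A u v : A \in unitmx -> A^T = A ->
  (forall w, bform A u w = bform A v w) -> u = v.
Proof.
move=> uA sA uv; apply/eqP; rewrite -subr_eq0; apply/eqP.
apply: (can_inj (mulmxK uA)); rewrite mul0mx.
apply/rowP => j; have := uv (delta_mx 0 j).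
move/eqP; rewrite -subr_eq0 -bformNl -bformDl /bform trmx_delta -colE !mxE => /eqP.
by [].
Qed.

End LeviCivita.

Section LeviCivitaProperties.
Variables (R : realType) (d : nat) (G : 'rV[R]_d -> 'M[R]_d).
Implicit Types (y z u v w : 'rV[R]_d).

Section AtPoint.
Variable y : 'rV[R]_d.
Hypothesis dG : differentiable G y.
Hypothesis uG : G y \in unitmx.
Hypothesis sG : \forall z \near y, (G z)^T = G z.

Let sGy : (G y)^T = G y. Proof. exact: nbhs_singleton sG. Qed.

Variable D : {linear 'rV[R]_d -> 'M[R]_d}.
Hypothesis DE : forall u, 'D_u G y = D u.

Let Dsym w u v : bform (D w) u v = bform (D w) v u.
Proof. by apply: bform_sym; rewrite -DE; exact: derive_tr_sym. Qed.

Let koszul u v w := levi_civita_koszul u v w dG uG DE.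

Lemma levi_civita_sym u v : levi_civita G y u v = levi_civita G y v u.
Proof.
apply: (bform_inj uG sGy) => w; rewrite !koszul (Dsym w u v).
by congr (_ * (_ - _)); exact: addrC.
Qed.

Lemma levi_civita_linear a u v w :
  levi_civita G y (a *: u + v) w = a *: levi_civita G y u w + levi_civita G y v w.
Proof.
apply: (bform_inj uG sGy) => t.
rewrite bformDl bformZl (koszul (a *: u + v)) (koszul u) (koszul v) linearD linearZ /=.
have bformZm b (A : 'M[R]_d) p q : bform (b *: A) p q = b * bform A p q.
  by rewrite /bform -scalemxAr -scalemxAl mxE.
rewrite !bformDm !bformDl !bformZl bformZm.
by ring.
Qed.

(** In the sum of the two Koszul expressions the derivatives along u and v cancel and the derivative
    along w is counted twice. *)
Lemma levi_civita_metric w u v : bform (D w) u v =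
  bform (G y) (levi_civita G y w u) v + bform (G y) u (levi_civita G y w v).
Proof.
rewrite [X in _ + X]bform_sym // !koszul (Dsym w v u) (Dsym u w v) (Dsym v w u).
by field.
Qed.

End AtPoint.

Lemma differentiable_levi_civita (V : set 'rV[R]_d) y u v :
  open V -> smooth_on V G -> (forall z, V z -> G z \in unitmx) -> V y ->
  differentiable (fun z => levi_civita G z u v) y.
Proof.
move=> oV sG uG Vy; have nV := open_nbhs_nbhs (conj oV Vy).
have dG z : V z -> differentiable G z by exact: smooth_on_differentiable.
have dDG w : differentiable ('D_w G) y.
  by apply: (@smooth_on_differentiable _ _ _ V) => //; exact: smooth_on_derive.
have dB w p q : differentiable (fun z => bform ('D_w G z) p q) y.
  by apply: differentiable_bform => //; exact: differentiable_cst.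
apply: (@near_eq_differentiable _ _ _ (fun z => (\row_k (2^-1 * (bform ('D_u G z) v (delta_mx 0 k)
     + bform ('D_v G z) u (delta_mx 0 k) - bform ('D_(delta_mx 0 k) G z) u v))) *m invmx (G z))).
  apply: filterS nV => z Vz; rewrite /levi_civita; congr (_ *m _).
  by apply/rowP => k; rewrite 2!mxE !derive_bform_cst //; exact: dG.
apply: differentiable_mulmx; last first.
  by apply: differentiable_invmx; [apply: filterS nV|exact: dG].
apply: differentiable_mx => i j; under eq_fun do rewrite mxE.
apply: differentiableM; first exact: differentiable_cst.
apply: differentiableB; last exact: dB.
by apply: differentiableD; exact: dB.
Qed.

End LeviCivitaProperties.

(** * Lie derivatives along xi and the symmetry of h' and phi h' *)

Section ContactTensor.
Variables (R : realType) (d : nat) (V : set 'rV[R]_d).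
Variables (phi G : 'rV[R]_d -> 'M[R]_d) (xi : 'rV[R]_d -> 'rV[R]_d).
Variables (eta : 'rV[R]_d -> 'cV[R]_d).
Implicit Types (y z u v w : 'rV[R]_d).
Hypotheses (oV : open V) (sphi : smooth_on V phi) (sG : smooth_on V G).
Hypotheses (sxi : smooth_on V xi) (seta : smooth_on V eta).
Hypothesis GT : forall y, V y -> (G y)^T = G y.
Hypothesis phi2 : forall y, V y -> phi y *m phi y = eta y *m xi y - 1%:M.
Hypothesis xi_eta : forall y, V y -> xi y *m eta y = 1%:M.
Hypothesis phi_eta : forall y, V y -> phi y *m eta y = 0.
Hypothesis G_phi : forall y, V y -> G y *m (phi y)^T = - (phi y *m G y).
Hypothesis G_xi : forall y, V y -> G y *m (xi y)^T = eta y.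
(** The left side is g(phi u, v) = - Phi(u, v), and the right side is - d eta(u, v) on constant
    fields. *)
Hypothesis contact : forall y u v, V y ->
  u *m (phi y *m G y) *m v^T = 2^-1 *: (u *m 'D_v eta y - v *m 'D_u eta y).

Variable y : 'rV[R]_d.
Hypothesis Vy : V y.

Let nV : nbhs y V. Proof. exact: open_nbhs_nbhs. Qed.
Let dphi z : V z -> differentiable phi z. Proof. exact: smooth_on_differentiable. Qed.
Let dG z : V z -> differentiable G z. Proof. exact: smooth_on_differentiable. Qed.
Let dxi z : V z -> differentiable xi z. Proof. exact: smooth_on_differentiable. Qed.
Let deta z : V z -> differentiable eta z. Proof. exact: smooth_on_differentiable. Qed.
Let dphiG z : V z -> differentiable (fun z => phi z *m G z) z.
Proof. by move=> Vz; apply: differentiable_mulmx; [exact: dphi|exact: dG]. Qed.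

Let B := jacobian xi y.
Let X := xi y.

Let DxiE u : 'D_u xi y = u *m B.
Proof. by apply: deriveEjacobian; exact: dxi. Qed.

Let near_derive m n (f g : 'rV[R]_d -> 'M[R]_(m, n)) u :
  (forall z, V z -> f z = g z) -> 'D_u f y = 'D_u g y.
Proof. by move=> fg; apply: near_eq_derive; apply: filterS nV. Qed.

(** This is L_xi eta = 0. By the contact condition d eta(u, xi) = 0, which exchanges u and xi in the
    derivative of eta; differentiating eta(xi) = 1 gives the rest. *)
Lemma lie_eta : 'D_X eta y + B *m eta y = 0.
Proof.
have De u : u *m 'D_X eta y = X *m 'D_u eta y.
  have : 2^-1 *: (u *m 'D_X eta y - X *m 'D_u eta y) = 0.
    by rewrite -contact // -mulmxA -mulmxA G_xi // phi_eta // mulmx0.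
  by move/eqP; rewrite scaler_eq0 invr_eq0 pnatr_eq0 /= subr_eq0 => /eqP.
have D1 u : u *m B *m eta y + X *m 'D_u eta y = 0.
  rewrite -DxiE -derive_mulmx; [|exact: dxi|exact: deta].
  by rewrite (near_derive (g := cst 1%:M)) ?derive_cst // => z Vz; exact: xi_eta.
apply/row_matrixP => i; rewrite rowE mulmxDr De mulmxA row0 addrC.
exact: D1.
Qed.

Let Dphi := 'D_X phi y.
Let DG := 'D_X G y.

Lemma lie_phi2 : Dphi *m phi y + phi y *m Dphi = 'D_X eta y *m X + eta y *m (X *m B).
Proof.
rewrite -derive_mulmx ?(near_derive (g := fun z => eta z *m xi z - 1%:M)) //; try exact: dphi.
rewrite deriveB; [|apply: diff_derivable|exact: derivable_cst].
  by rewrite derive_cst subr0 derive_mulmx ?DxiE //; [exact: deta|exact: dxi].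
by apply: differentiable_mulmx; [exact: deta|exact: dxi].
Qed.

Lemma lie_phi_eta : Dphi *m eta y + phi y *m 'D_X eta y = 0.
Proof.
rewrite -derive_mulmx ?(near_derive (g := cst 0)) ?derive_cst //; [exact: dphi|exact: deta].
Qed.

(** The 2-form g(phi u, v) = - d eta(u, v), evaluated on constant fields. *)
Let omega u v z := u *m (phi z *m G z) *m v^T.

Let omega_anti u v z : V z -> omega u v z = - omega v u z.
Proof.
by move=> Vz; rewrite /omega !contact // -scalerN opprB.
Qed.

Let D_omega w u v : 'D_w (omega u v) y = u *m 'D_w (fun z => phi z *m G z) y *m v^T.
Proof.
rewrite /omega derive_mulmxl; last first.
  by apply: differentiable_mulmx; [exact: differentiable_cst|exact: dphiG].
by rewrite derive_mulmxr //; exact: dphiG.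
Qed.

Let D_omega_eta w u v : 'D_w (omega u v) y =
  2^-1 *: (u *m 'D_w ('D_v eta) y - v *m 'D_w ('D_u eta) y).
Proof.
have dD t : differentiable ('D_t eta) y.
  by apply: (@smooth_on_differentiable _ _ _ V) => //; exact: smooth_on_derive.
have dD' s t : differentiable (fun z => s *m 'D_t eta z) y.
  by apply: differentiable_mulmx => //; exact: differentiable_cst.
rewrite (near_derive (g := fun z => 2^-1 *: (u *m 'D_v eta z - v *m 'D_u eta z))); last first.
  by move=> z Vz; exact: contact.
rewrite deriveZ; last first.
  by apply: derivableB; exact: diff_derivable.
have dv s t : derivable (fun z => s *m 'D_t eta z) y w by exact: diff_derivable.
rewrite (deriveB (dv _ u v) (dv _ v u)).
by congr (_ *: (_ - _)); [exact: (derive_mulmxr u w (dD v))|exact: (derive_mulmxr v w (dD u))].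
Qed.

(** dd eta = 0: the second derivatives of eta commute and cancel in the cyclic sum. *)
Lemma omega_closed w u v :
  'D_w (omega u v) y + 'D_u (omega v w) y + 'D_v (omega w u) y = 0.
Proof.
(* The second derivatives of eta are hidden behind a symmetric [Q], so that only linear algebra
   remains. *)
have [Q QE Qs] : exists2 Q : 'rV[R]_d -> 'rV[R]_d -> 'cV[R]_d,
    (forall w u v, 'D_w (omega u v) y = 2^-1 *: (u *m Q w v - v *m Q w u)) &
    (forall s t, Q s t = Q t s).
  exists (fun s t => 'D_s ('D_t eta) y); first exact: D_omega_eta.
  by move=> s t; exact: smooth_on_derive_comm Vy.
rewrite !QE (Qs u w) (Qs v w) (Qs u v) -!scalerDr.
by rewrite !addrA !subrK subrr scaler0.
Qed.

(** [X] is the constant vector xi(y). The field xi itself lies in the kernel of omega everywhere,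
    and differentiating omega(v, xi) = 0 by the product rule gives the formula. *)
Let D_omega_xi t v : 'D_t (omega v X) y = - omega v (t *m B) y.
Proof.
apply/eqP; rewrite -subr_eq0 opprK D_omega.
have dvG : differentiable (fun z => v *m (phi z *m G z)) y.
  by apply: differentiable_mulmx; [exact: differentiable_cst|exact: dphiG].
have dxiT : differentiable (fun z => (xi z)^T) y by apply: differentiable_trmx; exact: dxi.
have E1 : 'D_t (fun z => v *m (phi z *m G z)) y = v *m 'D_t (fun z => phi z *m G z) y.
  exact: derive_mulmxr (dphiG Vy).
have E2 : 'D_t (fun z => (xi z)^T) y = (t *m B)^T.
  by rewrite -DxiE; apply: derive_trmx; exact: dxi.
rewrite -E1 /omega -E2 -(derive_mulmx t dvG dxiT) (near_derive (g := cst 0)) ?derive_cst // => z Vz.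
by rewrite -!mulmxA G_xi // phi_eta // mulmx0.
Qed.

(** This is L_xi omega = 0, by Cartan's argument: omega is closed and its contraction with xi
    vanishes. *)
Lemma lie_omega u v :
  'D_X (omega u v) y + omega (u *m B) v y + omega u (v *m B) y = 0.
Proof.
have D1 w : 'D_v (omega X w) y = omega w (v *m B) y.
  rewrite (near_derive (g := fun z => - omega w X z)); last first.
    by move=> z Vz; exact: omega_anti.
  rewrite deriveN ?D_omega_xi ?opprK //; apply: diff_derivable.
  rewrite /omega; apply: differentiable_mulmx; last exact: differentiable_cst.
  by apply: differentiable_mulmx; [exact: differentiable_cst|exact: dphiG].
by have := omega_closed X u v; rewrite D1 D_omega_xi -omega_anti.
Qed.

Lemma lie_phiG : Dphi *m G y + phi y *m DG + B *m phi y *m G y + phi y *m G y *m B^T = 0.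
Proof.
apply: mx_eq_bform => u v; rewrite /bform mulmx0 mul0mx.
have := lie_omega u v; rewrite D_omega /omega trmx_mul derive_mulmx; [|exact: dphi|exact: dG].
by move=> E; rewrite -[in RHS]E !mulmxDr !mulmxDl !mulmxA.
Qed.

(** The matrix of h' in the row convention, in which [H *m phi y] is the matrix of phi h'. *)
Let H := 2^-1 *: (Dphi - phi y *m B + B *m phi y).

Lemma hprimeE u : hprime xi phi y u = u *m H.
Proof.
rewrite /hprime /H -scalemxAr; congr (_ *: _); rewrite /lie_endo /lie_bracket.
rewrite !derive_cst sub0r mulNmx opprK /= derive_mulmxr; last exact: dphi.
rewrite !DxiE.
by rewrite mulmxDr mulmxBr !mulmxA.
Qed.

(** Leibniz rule for phi^2 = - 1 + eta (x) xi: the Lie derivative of the right side along xi is zero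
    because L_xi eta = 0. *)
Let HphiE : H *m phi y + phi y *m H = 0.
Proof.
rewrite /H -scalemxAl -scalemxAr -scalerDr mulmxDr mulmxDl mulmxBr mulmxBl.
rewrite !mulmxA -[B *m _ *m _]mulmxA phi2 // mulmxBr mulmxBl mulmx1 mul1mx.
have := lie_phi2; have := congr1 (fun A => A *m X) lie_eta.
rewrite mul0mx mulmxDl !mulmxA.
set a := _ *m X; set b := _ *m X; set c := Dphi *m _; set e := phi y *m Dphi.
set f := _ *m B; set k := phi y *m B *m phi y => ab0 ce.
have -> : c - k + (b - B) + (e - (f - B) + k) = a + b + (c + e - (a + f)).
  by apply/matrixP => i j; rewrite !mxE; ring.
by rewrite ab0 ce subrr addr0 scaler0.
Qed.

Let Heta : H *m eta y = 0.
Proof.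
rewrite /H -scalemxAl mulmxDl mulmxBl -[B *m _ *m _]mulmxA phi_eta // mulmx0 addr0.
have -> : phi y *m B *m eta y = - (phi y *m 'D_X eta y).
  by rewrite -mulmxA -mulmxN; congr (_ *m _); apply/eqP; rewrite -addr_eq0 addrC lie_eta.
by rewrite opprK lie_phi_eta scaler0.
Qed.

(** The Lie derivative of the metric along xi. *)
Let S := DG + B *m G y + G y *m B^T.

(** Leibniz rule for L_xi (phi G) = 0, where 2 H is the Lie derivative of phi. *)
Let HG : H *m G y = - 2^-1 *: (phi y *m S).
Proof.
have E : Dphi *m G y = - (phi y *m DG + B *m phi y *m G y + phi y *m G y *m B^T).
  by apply/eqP; rewrite -addr_eq0 !addrA lie_phiG.
rewrite /H -scalemxAl mulmxDl mulmxBl E scaleNr -scalerN; congr (_ *: _).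
rewrite /S !mulmxDr !mulmxA.
by apply/matrixP => i j; rewrite !mxE; ring.
Qed.

(** Moving phi across G by skewness turns the matrix into half of phi S phi^T, which is symmetric
    because S is. *)
Lemma phi_hprime_sym : (H *m phi y *m G y)^T = H *m phi y *m G y.
Proof.
have ST : S^T = S.
  rewrite /S !linearD /= !trmx_mul trmxK GT // derive_tr_sym //; last exact: dG.
    by rewrite addrAC.
  exact: filterS nV.
have -> : H *m phi y *m G y = 2^-1 *: (phi y *m S *m (phi y)^T).
  rewrite -mulmxA -[phi y *m G y]opprK -G_phi // mulmxN mulmxA HG.
  by rewrite -scalemxAl scaleNr opprK.
by rewrite linearZ /= !trmx_mul trmxK ST mulmxA.
Qed.

(** Since phi and h' anticommute and eta h' = 0, h' is recovered from phi h' by multiplying once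
    more by phi. The terms in eta (x) xi coming from phi^2 vanish on both sides of the
    transposition. *)
Lemma hprime_sym : (H *m G y)^T = H *m G y.
Proof.
have phiH : phi y *m H = - (H *m phi y) by apply/eqP; rewrite -addr_eq0 addrC HphiE.
have E1 : phi y *m (H *m phi y *m G y) = H *m G y.
  rewrite !mulmxA phiH -[- _ *m _ *m _]mulmxA.
  by rewrite mulNmx mulmxA -(mulmxA H) phi2 // mulmxBr mulmx1 mulmxA Heta mul0mx sub0r mulNmx opprK.
have XGH : X *m G y *m H^T = 0.
  apply: (can_inj (@trmxK _ _ _)); rewrite !trmx_mul trmxK GT // trmx0 G_xi //.
have E2 : H *m phi y *m G y = - (phi y *m G y *m H^T).
  by rewrite -phi_hprime_sym !trmx_mul GT // mulmxA G_phi // mulNmx.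
rewrite trmx_mul GT // -E1 E2 mulmxN !mulmxA phi2 // !mulmxBl !mul1mx opprB.
by rewrite -!mulmxA (mulmxA X) XGH mulmx0 subr0.
Qed.

End ContactTensor.

(** * Calculus along an immersion and for a general ambient connection *)

Section Pushforward.
Variables (R : realType) (n d : nat) (U : set 'rV[R]_n) (F : 'rV[R]_n -> 'rV[R]_d).
Hypotheses (oU : open U) (sF : smooth_on U F).
Implicit Types (q u v w : 'rV[R]_n).

Lemma pushvE q u : U q -> 'D_u F q = pushv F q u.
Proof. by move=> Uq; apply: deriveEjacobian; exact: smooth_on_differentiable Uq. Qed.

Let near_pushv q w : U q -> \forall z \near q, 'D_w F z = pushv F z w.
Proof.
move=> Uq; apply: filterS (open_nbhs_nbhs (conj oU Uq)) => z Uz; exact: pushvE.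
Qed.

Let near_Dpushv q u w : U q ->
  \forall z \near q, 'D_u ('D_w F) z = 'D_u (pushv F ^~ w) z.
Proof.
move=> Uq; apply: filterS (open_nbhs_nbhs (conj oU Uq)) => z Uz.
by apply: near_eq_derive; exact: near_pushv.
Qed.

Lemma differentiable_pushv q w : U q -> differentiable (pushv F ^~ w) q.
Proof.
move=> Uq; apply: near_eq_differentiable (near_pushv w Uq) _.
by apply: (@smooth_on_differentiable _ _ _ U) => //; exact: smooth_on_derive.
Qed.

Lemma differentiable_jacobian q : U q -> differentiable (jacobian F) q.
Proof.
move=> Uq; apply: differentiable_mx => i j.
have dp := @differentiable_mxE _ _ _ _ _ _ 0 j (differentiable_pushv (delta_mx 0 i) Uq).
apply: near_eq_differentiable dp; near=> z.
by rewrite /pushv -rowE mxE.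
Unshelve. all: by end_near. Qed.

Lemma differentiable_derive_pushv q u w : U q -> differentiable ('D_u (pushv F ^~ w)) q.
Proof.
move=> Uq; apply: near_eq_differentiable (near_Dpushv u w Uq) _.
by apply: (@smooth_on_differentiable _ _ _ U) => //; do 2 apply: smooth_on_derive.
Qed.

(** Both sides are second derivatives of F. This symmetry later makes the second fundamental form
    symmetric. *)
Lemma derive_pushv_sym q u w : U q -> 'D_u (pushv F ^~ w) q = 'D_w (pushv F ^~ u) q.
Proof.
move=> Uq; have E1 := nbhs_singleton (near_Dpushv u w Uq).
have E2 := nbhs_singleton (near_Dpushv w u Uq).
exact: etrans (esym E1) (etrans (smooth_on_derive_comm w u oU sF Uq) E2).
Qed.

Lemma derive_derive_pushv_sym q u v w : U q ->
  'D_u ('D_v (pushv F ^~ w)) q = 'D_v ('D_u (pushv F ^~ w)) q.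
Proof.
have E s t : U q -> 'D_s ('D_t ('D_w F)) q = 'D_s ('D_t (pushv F ^~ w)) q.
  by move=> Uq; apply: near_eq_derive; exact: near_Dpushv.
move=> Uq; have sDF : smooth_on U ('D_w F) by exact: smooth_on_derive.
have C : 'D_u ('D_v ('D_w F)) q = 'D_v ('D_u ('D_w F)) q.
  exact: smooth_on_derive_comm Uq.
exact (etrans (esym (E u v Uq)) (etrans C (E v u Uq))).
Qed.

End Pushforward.

Section AmbientConnection.
Variables (R : realType) (n d : nat) (V : set 'rV[R]_d).
Variable Gam : 'rV[R]_d -> 'rV[R]_d -> 'rV[R]_d -> 'rV[R]_d.
Hypothesis oV : open V.
Hypothesis Gaml : forall y a u v w, V y ->
  Gam y (a *: u + v) w = a *: Gam y u w + Gam y v w.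
Hypothesis Gamr : forall y a u v w, V y ->
  Gam y w (a *: u + v) = a *: Gam y w u + Gam y w v.
Hypothesis dGam : forall y u v, V y -> differentiable (fun z => Gam z u v) y.
Implicit Types (y z u v w : 'rV[R]_d).

Lemma Gam0l y w : V y -> Gam y 0 w = 0.
Proof. by move=> Vy; have := Gaml (-1) 0 0 w Vy; rewrite scaler0 addr0 scaleN1r addNr. Qed.

Lemma GamDr y u v w : V y -> Gam y w (u + v) = Gam y w u + Gam y w v.
Proof. by move=> Vy; have := Gamr 1 u v w Vy; rewrite !scale1r. Qed.

(** The Christoffel symbols with upper index k. Through them each component of [Gam] is a bilinear
    form, and the product rule for [bform] applies. *)
Let M k z : 'M[R]_d := \matrix_(i, j) Gam z (delta_mx 0 i) (delta_mx 0 j) 0 k.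

Let GamE z u v k : V z -> Gam z u v 0 k = bform (M k z) u v.
Proof.
move=> Vz.
have lin_sum (f : 'rV[R]_d -> 'rV[R]_d) t : (forall a u v, f (a *: u + v) = a *: f u + f v) ->
    f t = \sum_j t 0 j *: f (delta_mx 0 j).
  move=> fl.
  pose flM := GRing.isLinear.Build _ _ _ _ f fl.
  pose fL : {linear _ -> _} := HB.pack f flM.
  rewrite {1}(row_sum_delta t) -[f]/(fL : _ -> _) linear_sum.
  by apply: eq_bigr => j _; rewrite linearZ.
rewrite (lin_sum (Gam z ^~ v)) => [|*]; last exact: Gaml.
rewrite summxE {2}(row_sum_delta u) bform_suml; apply: eq_bigr => i _.
rewrite bformZl mxE (lin_sum (Gam z _)) => [|*]; last exact: Gamr.
rewrite summxE {2}(row_sum_delta v) bform_sumr; congr (_ * _); apply: eq_bigr => j _.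
by rewrite bformZr mxE /bform trmx_delta -rowE -colE !mxE.
Qed.

Let dM k y : V y -> differentiable (M k) y.
Proof.
move=> Vy; apply: differentiable_mx => i j; under eq_fun do rewrite mxE.
by apply: differentiable_mxE; exact: dGam.
Qed.

Variables (F A B : 'rV[R]_n -> 'rV[R]_d) (p : 'rV[R]_n).
Hypotheses (dF : differentiable F p) (dA : differentiable A p) (dB : differentiable B p).
Hypothesis VF : V (F p).

Let near_GamE k : \forall q \near p, bform (M k (F q)) (A q) (B q) = Gam (F q) (A q) (B q) 0 k.
Proof.
have cF : {for p, continuous F} by exact: differentiable_continuous.
have nV : \forall q \near p, V (F q) by exact: (cF _ (open_nbhs_nbhs (conj oV VF))).
by apply: filterS nV => q VFq; rewrite GamE.
Qed.

Let dMF k : differentiable (fun q => M k (F q)) p.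
Proof. by apply: differentiable_comp => //; exact: dM. Qed.

Lemma differentiable_Gam : differentiable (fun q => Gam (F q) (A q) (B q)) p.
Proof.
apply: differentiable_mx => i k; rewrite (ord1 i).
by apply: near_eq_differentiable (near_GamE k) _; exact: differentiable_bform.
Qed.

Lemma derive_Gam (u : 'rV[R]_n) : 'D_u (fun q => Gam (F q) (A q) (B q)) p =
  'D_('D_u F p) (fun z => Gam z (A p) (B p)) (F p)
  + Gam (F p) ('D_u A p) (B p) + Gam (F p) (A p) ('D_u B p).
Proof.
have addmxE q r (C D : 'M[R]_(q, r)) i j : (C + D) i j = C i j + D i j by rewrite mxE.
apply/rowP => k; rewrite derive_mxE; last exact: differentiable_Gam.
rewrite -(near_eq_derive u (near_GamE k)) derive_bform //.
rewrite 2!addmxE !GamE //; congr (_ + _ + _).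
rewrite derive_mxE; last exact: dGam.
have E : \forall z \near F p, bform (M k z) (A p) (B p) = Gam z (A p) (B p) 0 k.
  by apply: filterS (open_nbhs_nbhs (conj oV VF)) => z Vz; rewrite GamE.
rewrite -(near_eq_derive _ E) derive_bform_cst; last exact: dM.
by rewrite (derive_chain u dF (dM k VF)).
Qed.

End AmbientConnection.

(** * Curvature of the modified connection *)

Section ConstantCurvature.
Variables (R : realType) (d : nat).
Variable Gam : 'rV[R]_d -> 'rV[R]_d -> 'rV[R]_d -> 'rV[R]_d.
Implicit Types (y z u v w : 'rV[R]_d).

Lemma lie_bracket_cst u v : lie_bracket (cst u) (cst v) = cst 0.
Proof. by apply/funext => z; rewrite /lie_bracket !derive_cst subr0. Qed.

Lemma covderiv_cst v w : covderiv Gam (cst v) (cst w) = fun z => Gam z v w.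
Proof. by apply/funext => z; rewrite /covderiv derive_cst add0r. Qed.

Lemma curvature_cst y u v w : Gam y 0 w = 0 ->
  curvature (covderiv Gam) (cst u) (cst v) (cst w) y =
  'D_u (fun z => Gam z v w) y + Gam y u (Gam y v w)
  - ('D_v (fun z => Gam z u w) y + Gam y v (Gam y u w)).
Proof.
move=> G0; rewrite /curvature lie_bracket_cst !covderiv_cst /covderiv /=.
by rewrite G0 subr0.
Qed.

End ConstantCurvature.

Lemma deriveZl (R : realType) (V W : normedModType R) (k : V -> R) (w : W) x u :
  differentiable k x -> 'D_u (fun z => k z *: w) x = 'D_u k x *: w.
Proof.
by move=> dk; rewrite deriveE; [rewrite diffZl // deriveE|exact: differentiableZl].
Qed.

Section TildeCurvature.
Variables (R : realType) (d : nat) (V : set 'rV[R]_d).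
Variables (G : 'rV[R]_d -> 'M[R]_d) (P : 'rV[R]_d -> 'rV[R]_d) (a b : R).
Hypotheses (oV : open V) (sG : smooth_on V G) (sP : smooth_on V P).
Hypothesis GT : forall y, V y -> (G y)^T = G y.
Hypothesis uG : forall y, V y -> G y \in unitmx.
Implicit Types (y z u v w : 'rV[R]_d).

Let nearV y : V y -> nbhs y V. Proof. by move=> Vy; exact: open_nbhs_nbhs. Qed.

Lemma LC_sym y u v : V y -> levi_civita G y u v = levi_civita G y v u.
Proof.
move=> Vy; have dG : differentiable G y by exact: smooth_on_differentiable Vy.
apply: (@levi_civita_sym _ _ _ _ dG (uG Vy) _ ('d G y)).
  by apply: filterS (nearV Vy).
by move=> t; exact: deriveE.
Qed.

Lemma LC_linearl y c u v w : V y ->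
  levi_civita G y (c *: u + v) w = c *: levi_civita G y u w + levi_civita G y v w.
Proof.
move=> Vy; have dG : differentiable G y by exact: smooth_on_differentiable Vy.
apply: (@levi_civita_linear _ _ _ _ dG (uG Vy) _ ('d G y)).
  by apply: filterS (nearV Vy).
by move=> t; exact: deriveE.
Qed.

Lemma LC_linearr y c u v w : V y ->
  levi_civita G y w (c *: u + v) = c *: levi_civita G y w u + levi_civita G y w v.
Proof.
move=> Vy; rewrite (LC_sym w (c *: u + v) Vy) (LC_linearl c u v w Vy).
exact (congr2 (fun p q => c *: p + q) (LC_sym u w Vy) (LC_sym v w Vy)).
Qed.

Lemma LC_metric y w u v : V y -> bform ('D_w G y) u v =
  bform (G y) (levi_civita G y w u) v + bform (G y) u (levi_civita G y w v).
Proof.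
move=> Vy; have dG : differentiable G y by exact: smooth_on_differentiable Vy.
have DE t : 'D_t G y = 'd G y t by exact: deriveE.
rewrite DE; apply: (@levi_civita_metric _ _ _ _ dG (uG Vy) _ ('d G y)) => //.
by apply: filterS (nearV Vy).
Qed.

Lemma LC_differentiable y u v : V y -> differentiable (fun z => levi_civita G z u v) y.
Proof. by move=> Vy; exact: differentiable_levi_civita oV sG uG Vy. Qed.

Local Notation Gam := (tilde_conn G P a b).

Lemma tilde_linearl y c u v w : V y ->
  Gam y (c *: u + v) w = c *: Gam y u w + Gam y v w.
Proof.
move=> Vy; rewrite /tilde_conn (LC_linearl c u v w Vy) /pi_form bformDr bformZr.
move: (levi_civita _ _ _ _) (levi_civita _ _ _ _) (bform _ _ _) (bform _ _ _) (bform _ _ _).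
by move=> *; apply/rowP => k; rewrite !mxE; ring.
Qed.

Lemma tilde_linearr y c u v w : V y ->
  Gam y w (c *: u + v) = c *: Gam y w u + Gam y w v.
Proof.
move=> Vy; rewrite /tilde_conn (LC_linearr c u v w Vy) /pi_form bformDr bformZr.
move: (levi_civita _ _ _ _) (levi_civita _ _ _ _) (bform _ _ _) (bform _ _ _) (bform _ _ _).
by move=> *; apply/rowP => k; rewrite !mxE; ring.
Qed.

Lemma differentiable_pi_form y u : V y -> differentiable (fun z => pi_form G P z u) y.
Proof.
move=> Vy; apply: differentiable_bform; last exact: differentiable_cst.
- exact: smooth_on_differentiable sG Vy.
- exact: smooth_on_differentiable sP Vy.
Qed.

Lemma tilde_differentiable y u v : V y -> differentiable (fun z => Gam z u v) y.
Proof.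
move=> Vy; rewrite /tilde_conn; apply: differentiableD.
  apply: differentiableD; first exact: LC_differentiable.
  apply: differentiableZl; apply: differentiableM; first exact: differentiable_cst.
  exact: differentiable_pi_form.
apply: differentiableZl; apply: differentiableM; first exact: differentiable_cst.
exact: differentiable_pi_form.
Qed.

Lemma derive_tilde y t u v : V y -> 'D_t (fun z => Gam z u v) y =
  'D_t (fun z => levi_civita G z u v) y + (a * 'D_t (fun z => pi_form G P z u) y) *: v
  + (b * 'D_t (fun z => pi_form G P z v) y) *: u.
Proof.
move=> Vy.
have dL : differentiable (fun z => levi_civita G z u v) y by exact: LC_differentiable.
have dpi c w : differentiable (fun z => c * pi_form G P z w) y.
  by apply: differentiableM; [exact: differentiable_cst|exact: differentiable_pi_form].
have dpis c w s : differentiable (fun z => (c * pi_form G P z w) *: s) y.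
  exact: differentiableZl.
have DZ c w s : 'D_t (fun z => (c * pi_form G P z w) *: s) y =
    (c * 'D_t (fun z => pi_form G P z w) y) *: s.
  rewrite deriveZl //; congr (_ *: _); rewrite deriveZ //.
  by apply: diff_derivable; exact: differentiable_pi_form.
have dv1 := @diff_derivable _ _ _ _ _ t dL.
have dv2 c w s : derivable (fun z => (c * pi_form G P z w) *: s) y t by exact: diff_derivable.
have DD (f g : 'rV[R]_d -> 'rV[R]_d) : derivable f y t -> derivable g y t ->
    'D_t (fun z => f z + g z) y = 'D_t f y + 'D_t g y by exact: deriveD.
have dv12 : derivable (fun z => levi_civita G z u v + (a * pi_form G P z u) *: v) y t.
  by apply: derivableD; [exact: dv1|exact: dv2].
rewrite /tilde_conn (DD _ _ dv12 (dv2 _ b v u)); congr (_ + _); last exact: DZ.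
by rewrite (DD _ _ dv1 (dv2 _ a u v)); congr (_ + _); exact: DZ.
Qed.

Lemma alpha'E y u v : alpha' G P y u v =
  'D_u (fun z => pi_form G P z v) y - pi_form G P y (levi_civita G y u v).
Proof. by rewrite /alpha' /nabla_pi covderiv_cst. Qed.

(** Direct expansion on constant fields. Symmetry of the Levi-Civita coefficients removes the terms
    in pi of the covariant derivative of u along v, and the derivatives of pi recombine into
    [alpha']. *)
Lemma tilde_curvature y u v w : V y ->
  curvature (covderiv Gam) (cst u) (cst v) (cst w) y =
  riemann G y u v w + (a * (alpha' G P y u v - alpha' G P y v u)) *: w
  + (b * alpha' G P y u w) *: v - (b * alpha' G P y v w) *: u
  + (b ^+ 2 * pi_form G P y w) *: (pi_form G P y v *: u - pi_form G P y u *: v).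
Proof.
move=> Vy; rewrite /riemann !curvature_cst; first last.
- exact: (Gam0l tilde_linearl).
- exact: (Gam0l LC_linearl).
rewrite !derive_tilde // !alpha'E (LC_sym v u Vy).
move: ('D_u (fun z => levi_civita G z v w) y) ('D_v (fun z => levi_civita G z u w) y).
move: ('D_u (fun z => pi_form G P z v) y) ('D_v (fun z => pi_form G P z u) y).
move: ('D_u (fun z => pi_form G P z w) y) ('D_v (fun z => pi_form G P z w) y).
move=> Duw Dvw Duv Dvu Luvw Lvuw.
rewrite /tilde_conn.
have LCl3 s c t e r : levi_civita G y s (t + c *: w + e *: r) =
   levi_civita G y s t + c *: levi_civita G y s w + e *: levi_civita G y s r.
  rewrite addrC (LC_linearr e r (t + c *: w) s Vy) addrC [t + _]addrC.
  by rewrite (LC_linearr c w t s Vy) [_ + levi_civita _ _ _ t]addrC.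
rewrite !LCl3 /pi_form !bformDr !bformZr (LC_sym v u Vy).
move: (levi_civita G y u v) (levi_civita G y u w) (levi_civita G y v w) => Luv Luw Lvw.
move: (levi_civita _ _ _ _) (levi_civita _ _ _ _) => L1 L2.
move: (bform _ _ u) (bform _ _ v) (bform _ _ w) (bform _ _ Luv) (bform _ _ Luw) (bform _ _ Lvw).
by move=> *; apply/rowP => k; rewrite !mxE; ring.
Qed.

End TildeCurvature.

(** * The Gauss equation for the induced connection *)

Section Gauss.
Variables (R : realType) (n d : nat) (U : set 'rV[R]_n) (V : set 'rV[R]_d).
Variables (F : 'rV[R]_n -> 'rV[R]_d) (G : 'rV[R]_d -> 'M[R]_d).
Variables (P : 'rV[R]_d -> 'rV[R]_d) (a b : R).
Hypotheses (oU : open U) (oV : open V) (FUV : forall q, U q -> V (F q)).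
Hypotheses (sF : smooth_on U F) (sG : smooth_on V G) (sP : smooth_on V P).
Hypothesis rfF : forall q, U q -> row_free (jacobian F q).
Hypothesis GT : forall y, V y -> (G y)^T = G y.
Hypothesis G_gt0 : forall y u, V y -> u != 0 -> 0 < bform (G y) u u.
Implicit Types (q u v w t : 'rV[R]_n).

Local Notation J := (pushv F).
Local Notation gM q := (bform (induced_metric G F q)).
Local Notation gN q := (bform (G (F q))).
Local Notation Gam := (tilde_conn G P a b).

Let uG y : V y -> G y \in unitmx.
Proof. by move=> Vy; apply: posdef_unitmx => u; exact: G_gt0. Qed.

Lemma induced_metricE q u v : gM q u v = gN q (J q u) (J q v).
Proof. by rewrite /bform /induced_metric /pushv trmx_mul !mulmxA. Qed.

Lemma induced_metric_gt0 q u : U q -> u != 0 -> 0 < gM q u u.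
Proof.
move=> Uq u0; rewrite induced_metricE; apply: G_gt0; first exact: FUV.
by rewrite /pushv mulmx_free_eq0 // rfF.
Qed.

Lemma induced_metric_unit q : U q -> induced_metric G F q \in unitmx.
Proof. by move=> Uq; apply: posdef_unitmx => u; exact: induced_metric_gt0. Qed.

Lemma tangentialP q z t : U q -> gM q (tangential G F q z) t = gN q z (J q t).
Proof.
move=> Uq; rewrite /bform /tangential mulmxKV; last exact: induced_metric_unit.
by rewrite /pushv trmx_mul !mulmxA.
Qed.

Lemma tangential_pushv q u : U q -> tangential G F q (J q u) = u.
Proof.
move=> Uq; rewrite /tangential /pushv -!mulmxA [X in u *m X]mulmxA.
rewrite [X in u *m X]mulmxA -[_ *m G (F q) *m _]/(induced_metric G F q).
by rewrite mulmxV ?mulmx1 //; exact: induced_metric_unit.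
Qed.

Lemma tangentialD q z1 z2 :
  tangential G F q (z1 + z2) = tangential G F q z1 + tangential G F q z2.
Proof. by rewrite /tangential !mulmxDl. Qed.

Lemma tangentialZ q c z : tangential G F q (c *: z) = c *: tangential G F q z.
Proof. by rewrite /tangential -!scalemxAl. Qed.

Lemma normal_part_orth q z t : U q -> gN q (normal_part G F q z) (J q t) = 0.
Proof.
by move=> Uq; rewrite /normal_part bformDl bformNl -induced_metricE tangentialP // subrr.
Qed.

Lemma normal_part_pushv q z u : U q ->
  normal_part G F q (z + J q u) = normal_part G F q z.
Proof.
move=> Uq; rewrite /normal_part tangentialD tangential_pushv // /pushv mulmxDl.
by rewrite opprD addrACA subrr addr0.
Qed.

Let dF q : U q -> differentiable F q.
Proof. by move=> Uq; exact: smooth_on_differentiable sF Uq. Qed.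

Let Gl := @tilde_linearl R d V G P a b oV sG GT uG.
Let Gr := @tilde_linearr R d V G P a b oV sG GT uG.
Let dGam y (u v : 'rV[R]_d) : V y -> differentiable (fun z => Gam z u v) y.
Proof. by move=> Vy; apply: (tilde_differentiable a b oV sG sP uG u v Vy). Qed.

(** The pulled-back connection acting on fields along F, in a constant direction u. *)
Let cov u (Z : 'rV[R]_n -> 'rV[R]_d) q := 'D_u Z q + Gam (F q) (J q u) (Z q).

Let cov_differentiable u w q : U q -> differentiable (cov u (J ^~ w)) q.
Proof.
move=> Uq; apply: differentiableD; first exact: (differentiable_derive_pushv oU sF u w Uq).
apply: (differentiable_Gam oV Gl Gr dGam (dF Uq)); last exact: FUV.
- exact: (differentiable_pushv oU sF u Uq).
- exact: (differentiable_pushv oU sF w Uq).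
Qed.

(** The curvature of a pulled-back connection is the pull-back of the curvature. The remaining terms
    cancel because second and third derivatives of F are symmetric. *)
Lemma cov_commutator u v w q : U q ->
  cov u (cov v (J ^~ w)) q - cov v (cov u (J ^~ w)) q =
  curvature (covderiv Gam) (cst (J q u)) (cst (J q v)) (cst (J q w)) (F q).
Proof.
move=> Uq; have Vq := FUV Uq.
have dJ s : differentiable (J ^~ s) q by exact: (differentiable_pushv oU sF s Uq).
rewrite curvature_cst; last by exact (Gam0l Gl _ Vq).
have E s t : cov s (cov t (J ^~ w)) q = 'D_s ('D_t (J ^~ w)) q +
   ('D_(J q s) (fun z => Gam z (J q t) (J q w)) (F q)
    + Gam (F q) ('D_s (J ^~ t) q) (J q w) + Gam (F q) (J q t) ('D_s (J ^~ w) q))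
   + (Gam (F q) (J q s) ('D_t (J ^~ w) q) + Gam (F q) (J q s) (Gam (F q) (J q t) (J q w))).
  have D1 : 'D_s (cov t (J ^~ w)) q = 'D_s ('D_t (J ^~ w)) q +
      'D_s (fun q => Gam (F q) (J q t) (J q w)) q.
    apply: deriveD; apply: diff_derivable.
      exact: (differentiable_derive_pushv oU sF t w Uq).
    exact: (differentiable_Gam oV Gl Gr dGam (dF Uq) (dJ t) (dJ w) Vq).
  rewrite {1}/cov D1 (derive_Gam oV Gl Gr dGam (dF Uq) (dJ t) (dJ w) Vq).
  by rewrite (pushvE sF s Uq) /cov (GamDr Gr _ _ _ Vq).
have alg (D1 D2 X1 X2 Y1 Y2 Z1 Z2 Q1 Q2 : 'rV[R]_d) : D1 = D2 -> Y1 = Y2 ->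
    D1 + (X1 + Y1 + Z1) + (Z2 + Q1) - (D2 + (X2 + Y2 + Z2) + (Z1 + Q2)) =
    X1 + Q1 - (X2 + Q2).
  by move=> -> ->; apply/rowP => k; rewrite !mxE; ring.
apply: etrans (congr2 (fun x1 x2 => x1 - x2) (E u v) (E v u)) _.
apply: alg; first exact (derive_derive_pushv_sym oU sF u v w Uq).
exact (congr1 (fun z => Gam (F q) z (J q w)) (derive_pushv_sym oU sF u v Uq)).
Qed.

(** The corrections by a and b are tangent to the submanifold, so they are lost in the normal part
    and only the Levi-Civita connection counts. *)
Lemma second_formE u v q : U q -> second_form G F Gam (cst u) (cst v) q =
  normal_part G F q ('D_u (J ^~ v) q + levi_civita G (F q) (J q u) (J q v)).
Proof.
move=> Uq; rewrite /second_form /cov_along /tilde_conn -!/(J q _).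
have JZ c w : c *: J q w = J q (c *: w) by rewrite /pushv scalemxAl.
by rewrite !JZ !addrA !normal_part_pushv.
Qed.

Lemma second_form_sym u v q : U q ->
  second_form G F Gam (cst u) (cst v) q = second_form G F Gam (cst v) (cst u) q.
Proof.
move=> Uq; apply: etrans (second_formE u v Uq) _; apply: etrans (esym (second_formE v u Uq)).
exact (congr2 (fun x1 x2 => normal_part G F q (x1 + x2)) (derive_pushv_sym oU sF u v Uq)
  (LC_sym oV sG GT uG _ _ (FUV Uq))).
Qed.

Lemma second_form_linear c u v w q : U q ->
  second_form G F Gam (cst (c *: u + v)) (cst w) q =
  c *: second_form G F Gam (cst u) (cst w) q + second_form G F Gam (cst v) (cst w) q.
Proof.
move=> Uq; have dJ := differentiable_pushv oU sF w Uq.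
have J_linear : J q (c *: u + v) = c *: J q u + J q v.
  by rewrite /pushv mulmxDl scalemxAl.
have normalD z1 z2 : normal_part G F q (c *: z1 + z2) =
    c *: normal_part G F q z1 + normal_part G F q z2.
  rewrite /normal_part tangentialD tangentialZ /pushv mulmxDl -scalemxAl.
  by rewrite opprD addrACA scalerBr.
have D1 : 'D_(c *: u + v) (J ^~ w) q = c *: 'D_u (J ^~ w) q + 'D_v (J ^~ w) q.
  by apply: etrans (deriveDl _ _ dJ) _; congr (_ + _); exact: deriveZdir.
rewrite /second_form /cov_along /= D1 -!/(J q _) J_linear Gl; last exact: FUV.
by rewrite addrACA -scalerDr normalD.
Qed.

(** Weingarten formula, obtained by differentiating g(N, J t) = 0 with the metric Levi-Civita
    connection. Of the two correction terms, the one in a is a multiple of N and drops out; the one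
    in b survives as b pi(N) J u. *)
Lemma normal_field_derive (N : 'rV[R]_n -> 'rV[R]_d) u t q : U q ->
  differentiable N q -> (forall r s, U r -> gN r (N r) (J r s) = 0) ->
  gN q (cov u N q) (J q t) =
  b * pi_form G P (F q) (N q) * gN q (J q u) (J q t)
  - gN q (N q) (second_form G F Gam (cst u) (cst t) q).
Proof.
move=> Uq dN N0; have Vq := FUV Uq.
have dJ : differentiable (J ^~ t) q by exact: (differentiable_pushv oU sF t Uq).
have dGy : differentiable G (F q) by exact: smooth_on_differentiable sG Vq.
have dGF : differentiable (fun r => G (F r)) q.
  by apply: differentiable_comp; [exact: dF|exact: dGy].
have E0 : 'D_u (fun r => gN r (N r) (J r t)) q = 0.
  have E : \forall r \near q, gN r (N r) (J r t) = cst 0 r.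
    by apply: filterS (open_nbhs_nbhs (conj oU Uq)) => r Ur; exact: N0.
  by rewrite (near_eq_derive u E) derive_cst.
have : bform ('D_(J q u) G (F q)) (N q) (J q t) + gN q ('D_u N q) (J q t)
     + gN q (N q) ('D_u (J ^~ t) q) = 0.
  rewrite -[RHS]E0 (derive_bform u dGF dN dJ) (derive_chain u (dF Uq) dGy).
  by rewrite (pushvE sF u Uq).
rewrite (LC_metric oV sG GT uG (J q u) (N q) (J q t) Vq).
have Nn z : gN q (N q) (normal_part G F q z) = gN q (N q) z.
  by rewrite /normal_part bformDr bformNr N0 // subr0.
rewrite /second_form Nn /cov /cov_along /tilde_conn -/(J q u) -/(J q t).
rewrite !bformDl !bformDr !bformZl !bformZr !(N0 q _ Uq).
move: (bform _ ('D_u N q) _) (bform _ _ ('D_u (J ^~ t) q)).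
move: (bform _ (levi_civita _ _ _ _) _) (bform _ _ (levi_civita _ _ _ _)).
move: (bform _ (J q u) _) (pi_form _ _ _ _) (pi_form _ _ _ _) (pi_form _ _ _ _).
by move=> k1 k2 k3 k4 x1 x2 x3 x4 E; rewrite !mulr0 !addr0; lra.
Qed.

Lemma gauss_equation p u v w t : U p ->
  Rsub G F Gam p u v w t =
  gN p (curvature (covderiv Gam) (cst (J p u)) (cst (J p v)) (cst (J p w)) (F p)) (J p t)
  + gN p (second_form G F Gam (cst v) (cst w) p) (second_form G F Gam (cst u) (cst t) p)
  - gN p (second_form G F Gam (cst u) (cst w) p) (second_form G F Gam (cst v) (cst t) p)
  - b * pi_form G P (F p) (second_form G F Gam (cst v) (cst w) p) * gN p (J p u) (J p t)
  + b * pi_form G P (F p) (second_form G F Gam (cst u) (cst w) p) * gN p (J p v) (J p t).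
Proof.
move=> Up; have Vp := FUV Up.
(* The covariant derivative of J w along s is split into its normal part [N s] and its tangential
   part [T s]. *)
pose N s q := second_form G F Gam (cst s) (cst w) q.
pose T s q := J q (induced_conn G F Gam (cst s) (cst w) q).
have NE s : N s = fun q => cov s (J ^~ w) q - T s q by [].
have dT s : differentiable (T s) p.
  apply: differentiable_mulmx; last exact: (differentiable_jacobian oU sF Up).
  have dGF : differentiable (fun q => G (F q)) p.
    by apply: differentiable_comp; [exact: dF|exact: smooth_on_differentiable sG Vp].
  have dJac := differentiable_jacobian oU sF Up.
  have dJT := differentiable_trmx dJac.
  apply: differentiable_mulmx; last first.
    apply: differentiable_invmx; last first.
      by apply: differentiable_mulmx => //; exact: differentiable_mulmx.
    by apply: filterS (open_nbhs_nbhs (conj oU Up)) => q; exact: induced_metric_unit.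
  apply: differentiable_mulmx; last exact: dJT.
  by apply: differentiable_mulmx; [exact: cov_differentiable|exact: dGF].
have dN s : differentiable (N s) p.
  by rewrite NE; apply: differentiableB; [exact: cov_differentiable|exact: dT].
have North s q r : U q -> gN q (N s q) (J q r) = 0 by exact: normal_part_orth.
have covB r s : cov r (T s) p = cov r (cov s (J ^~ w)) p - cov r (N s) p.
  have D1 : 'D_r (N s) p = 'D_r (cov s (J ^~ w)) p - 'D_r (T s) p.
    by apply: deriveB; apply: diff_derivable; [exact: cov_differentiable|exact: dT].
  have G1 : Gam (F p) (J p r) (cov s (J ^~ w) p) =
      Gam (F p) (J p r) (N s p) + Gam (F p) (J p r) (T s p).
    by rewrite -(GamDr Gr _ _ _ Vp) NE subrK.
  rewrite {2}/cov [X in _ - X]/cov G1 D1 /cov.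
  move: ('D_r (cov s (J ^~ w)) p) ('D_r (T s) p) => A1 A2.
  move: (Gam _ _ _) (Gam _ _ _) => A3 A4.
  by apply/rowP => k; rewrite !mxE; ring.
(* Pairing with the tangent vector J t undoes the outer tangential projection, and constant fields
   have zero bracket. *)
have RE : Rsub G F Gam p u v w t = gN p (cov u (T v) p) (J p t) - gN p (cov v (T u) p) (J p t).
  rewrite /Rsub /curvature bformDl bformNl bformDl bformNl /induced_conn !tangentialP //.
  rewrite lie_bracket_cst /cov_along /= derive0 /pushv mul0mx (Gam0l Gl) // add0r bform0l subr0.
  by [].
have bformBl x1 x2 : gN p (x1 - x2) (J p t) = gN p x1 (J p t) - gN p x2 (J p t).
  by rewrite bformDl bformNl.
have L r s := etrans (congr1 (fun z => gN p z (J p t)) (covB r s)) (etrans (bformBl _ _)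
  (congr1 (fun z => _ - z) (normal_field_derive r t Up (dN s) (North s)))).
have C := etrans (esym (bformBl _ _))
  (congr1 (fun z => gN p z (J p t)) (cov_commutator u v w Up)).
have alg (x1 x2 c k1 k2 n1 n2 m1 m2 : R) : x1 - x2 = c ->
    x1 - (b * k1 * m1 - n1) - (x2 - (b * k2 * m2 - n2)) =
    c + n1 - n2 - b * k1 * m1 + b * k2 * m2.
  by move=> <-; ring.
exact (etrans RE (etrans (congr2 (fun x1 x2 => x1 - x2) (L u v) (L v u)) (alg _ _ _ _ _ _ _ _ _ C))).
Qed.

End Gauss.

(** * Orthonormal bases and the averaging of k-Ricci curvatures *)

Section OrthonormalBasis.
Variables (R : realType) (n : nat) (A : 'M[R]_n) (e : 'I_n -> 'rV[R]_n).
Hypothesis AT : A^T = A.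
Hypothesis e_on : forall i j, bform A (e i) (e j) = (i == j)%:R.
Implicit Types (u v w t : 'rV[R]_n).

Let E : 'M[R]_n := \matrix_i e i.

Lemma orthonormal_sum u : u = \sum_i bform A u (e i) *: e i.
Proof.
have EE : (E *m A) *m E^T = 1%:M.
  apply/matrixP => i j; rewrite [RHS]mxE -e_on /bform !mxE; apply: eq_bigr => k _.
  by rewrite !mxE; congr (_ * _); apply: eq_bigr => l _; rewrite mxE.
(* A one-sided inverse of a square matrix is two-sided, so orthonormality of the rows of E also
   yields completeness. *)
have AEE : A *m E^T *m E = 1%:M.
  by apply: (can_inj (@trmxK _ _ _)); rewrite !trmx_mul trmxK AT mulmx1C // trmx1.
rewrite -[LHS]mulmx1 -AEE !mulmxA [LHS]mulmx_sum_row; apply: eq_bigr => i _.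
rewrite rowK; congr (_ *: _); rewrite /bform !mxE; apply: eq_bigr => k _.
by rewrite !mxE.
Qed.

Lemma orthonormal_bform u v : bform A u v = \sum_i bform A u (e i) * bform A (e i) v.
Proof.
rewrite {1}(orthonormal_sum u) bform_suml.
by apply: eq_bigr => i _; rewrite bformZl.
Qed.

(** By Parseval, the squared coordinates of a unit vector add up to 1. *)
Lemma orthonormal_coord_le1 u i : bform A u u = 1 -> `|bform A u (e i)| <= 1.
Proof.
rewrite orthonormal_bform => u1; rewrite -(@ler_pXn2r _ 2) ?nnegrE // expr1n real_normK ?num_real //.
rewrite -[X in _ <= X]u1 (bigD1 i) //=.
rewrite (bform_sym (e i) u AT) -expr2 lerDl sumr_ge0 // => j _.
by rewrite (bform_sym (e j) u AT) -expr2 sqr_ge0.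
Qed.

Lemma linear_bound (f : 'rV[R]_n -> R) u :
  (forall a u v, f (a *: u + v) = a * f u + f v) -> bform A u u = 1 ->
  `|f u| <= \sum_i `|f (e i)|.
Proof.
move=> fl u1.
pose flM := GRing.isLinear.Build R 'rV[R]_n R *%R f fl.
pose fL : {scalar 'rV[R]_n} := HB.pack f flM.
rewrite {1}(orthonormal_sum u) -[f]/(fL : _ -> _) linear_sum.
apply: le_trans (ler_norm_sum _ _ _) _; apply: ler_sum => i _.
rewrite linearZ normrM; apply: ler_piMl => //; exact: orthonormal_coord_le1.
Qed.

End OrthonormalBasis.

Section ThetaBound.
Variables (R : realType) (n' d : nat).
(** With this form of the dimension, the n - 1 indices different from i are the images under
    [lift i] of ['I_n'.+1], which carries the addition modulo n - 1. *)
Local Notation n := n'.+2.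
Variables (G : 'rV[R]_d -> 'M[R]_d) (F : 'rV[R]_n -> 'rV[R]_d).
Variables (Gam : 'rV[R]_d -> 'rV[R]_d -> 'rV[R]_d -> 'rV[R]_d) (p : 'rV[R]_n).
Variable e : 'I_n -> 'rV[R]_n.
Implicit Types (u v w t : 'rV[R]_n).

Local Notation A := (induced_metric G F p).
Local Notation T := (Rsub G F Gam p).
Hypothesis AT : A^T = A.
Hypothesis e_on : forall i j, bform A (e i) (e j) = (i == j)%:R.
Hypothesis T1 : forall c u u' v w t, T (c *: u + u') v w t = c * T u v w t + T u' v w t.
Hypothesis T2 : forall c u v v' w t, T u (c *: v + v') w t = c * T u v w t + T u v' w t.
Hypothesis T3 : forall c u v w w' t, T u v (c *: w + w') t = c * T u v w t + T u v w' t.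
Hypothesis T4 : forall c u v w t t', T u v w (c *: t + t') = c * T u v w t + T u v w t'.

Let Rsub_bounded : exists C, forall u v w t, bform A u u = 1 -> bform A v v = 1 ->
  bform A w w = 1 -> bform A t t = 1 -> `|T u v w t| <= C.
Proof.
exists (\sum_i \sum_j \sum_k \sum_l `|T (e i) (e j) (e k) (e l)|) => u v w t u1 v1 w1 t1.
apply: le_trans (linear_bound AT e_on (fun c x y => T1 c x y v w t) u1) _.
apply: ler_sum => i _; apply: le_trans (linear_bound AT e_on (fun c x y => T2 c _ x y w t) v1) _.
apply: ler_sum => j _; apply: le_trans (linear_bound AT e_on (fun c x y => T3 c _ _ x y t) w1) _.
apply: ler_sum => k _; exact: (linear_bound AT e_on (fun c x y => T4 c _ _ _ x y) t1).
Qed.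

Variable k : nat.
Hypothesis k2 : (2 <= k <= n)%N.

Local Notation S := [set r | exists (L : 'M[R]_n) (u : 'rV[R]_n) (f : nat -> 'rV[R]_n),
        [/\ \rank L = k, (u <= L)%MS, bform A u u = 1,
            frame_of G F p k L u f & r = ricL G F Gam p k f]].

(** A multilinear form is bounded on unit vectors. Without a lower bound, [inf] would be a default
    value and could not be compared with the elements of [S]. *)
Let S_lbound : has_lbound S.
Proof.
have [C TC] := Rsub_bounded; exists (\sum_(1 <= j < k) - C) => _ [L [u [f [_ _ _ [f_on _ _] ->]]]].
rewrite /ricL big_nat [leRHS]big_nat; apply: ler_sum => j /andP[_ jk].
have k0 : (0 < k)%N by exact: leq_ltn_trans jk.
have f0 : bform A (f 0) (f 0) = 1 by rewrite f_on.
have fj : bform A (f j) (f j) = 1 by rewrite f_on // eqxx.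
rewrite /Ksub; have := TC _ _ _ _ f0 fj fj f0; have := TC _ _ _ _ f0 fj f0 fj.
by rewrite !ler_norml => /andP[? ?] /andP[? ?]; lra.
Qed.

(** The frame starts at e_i and continues through the other basis vectors in cyclic order from
    position s. Below k its entries are distinct, since k - 1 <= n - 1. *)
Let frame (i : 'I_n) (s : 'I_n'.+1) (l : nat) : 'rV[R]_n :=
  if l is l'.+1 then e (lift i (s + inord l')) else e i.

Let frame_S i s : S (ricL G F Gam p k (frame i s)).
Proof.
have /andP[k_ge2 k_len] := k2.
have f_on l m : (l < k)%N -> (m < k)%N ->
    bform A (frame i s l) (frame i s m) = (l == m)%:R.
  case: l m => [|l] [|m] lk mk; rewrite /frame e_on ?eqxx //.
  - by rewrite (negPf (neq_lift _ _)).
  - by rewrite eq_sym (negPf (neq_lift _ _)).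
  rewrite (inj_eq lift_inj) (inj_eq (addrI s)) eqSS; congr ((_ : bool)%:R).
  by rewrite -val_eqE /= !inordK //; lia.
(* The plane is the row space of this matrix, which has rank k because orthonormality makes
   [A *m B^T] a right inverse. *)
pose B : 'M[R]_(k, n) := \matrix_(l < k) frame i s l.
have fB l (lk : (l < k)%N) : frame i s l = row (Ordinal lk) B by rewrite rowK.
have B_free : row_free B.
  apply/row_freeP; exists (A *m B^T); rewrite mulmxA; apply/matrixP => l m.
  have -> : 1%:M l m = bform A (row l B) (row m B).
    by rewrite !rowK f_on // [LHS]mxE.
  rewrite /bform [LHS]mxE [RHS]mxE; apply: eq_bigr => q _.
  by congr (_ * _); [rewrite -row_mul [RHS]mxE|rewrite [LHS]mxE [RHS]mxE [RHS]mxE].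
exists <<B>>%MS, (frame i s 0), (frame i s); split => //.
- by rewrite mxrank_gen; apply/eqP.
- by rewrite genmxE (fB 0 (ltnW k_ge2)) row_sub.
- by rewrite f_on // ltnW.
split => //; by move=> l lk; rewrite genmxE (fB l lk) row_sub.
Qed.

(** The infimum is compared with the k-Ricci curvature of every frame (i, s). Summed over s, each
    pair (i, j) occurs once for each of the k - 1 later positions, and the factor k - 1 cancels that
    of [Theta]. *)
Lemma Theta_le :
  n%:R * (n%:R - 1) * Theta G F Gam p k <= \sum_i \sum_(j | j != i) Ksub G F Gam p (e i) (e j).
Proof.
have /andP[k_ge2 k_len] := k2.
have km1 : 0 < (k.-1)%:R :> R by rewrite ltr0n; lia.
have step i s : inf S <= ricL G F Gam p k (frame i s).
  exact: ge_inf S_lbound _ (frame_S i s).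
have rot (i : 'I_n) : \sum_s ricL G F Gam p k (frame i s) =
    (k.-1)%:R * \sum_(j | j != i) Ksub G F Gam p (e i) (e j).
  rewrite /ricL exchange_big /= big_add1.
  rewrite (eq_bigr (fun=> \sum_(j | j != i) Ksub G F Gam p (e i) (e j))); last first.
    (* At a fixed position, s |-> s + l is a bijection of the cyclic group and [lift i] a bijection
       onto the indices other than i; the default [ord0] occurs only for j = i, which is
       excluded. *)
    move=> l _; rewrite [RHS](reindex_onto (lift i) (fun j => odflt ord0 (unlift i j))) /=; last first.
      by move=> j; rewrite eq_sym => /unlift_some[j' -> ->].
    rewrite [RHS](eq_bigl predT); last first.
      by move=> j; rewrite eq_sym neq_lift liftK eqxx.
    rewrite [RHS](reindex_inj (addIr (inord l))) /=.
    by [].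
  by rewrite sumr_const_nat subn0 mulr_natl.
have : \sum_(i : 'I_n) \sum_(s : 'I_n'.+1) inf S <=
    \sum_(i : 'I_n) \sum_(s : 'I_n'.+1) ricL G F Gam p k (frame i s).
  by apply: ler_sum => i _; apply: ler_sum => s _; exact: step.
under [X in _ <= X]eq_bigr do rewrite rot.
rewrite -mulr_sumr !sumr_const !card_ord /Theta -/S.
have kV : 0 < (k.-1)%:R^-1 :> R by rewrite invr_gt0.
rewrite -(ler_pM2l kV) mulrA mulVf ?gt_eqF // mul1r; apply: le_trans.
have -> : n%:R - 1 = n'.+1%:R :> R by rewrite -[in LHS]natr1 addrK.
rewrite -[X in _ <= _ * X]mulr_natr -[X in _ <= _ * (X * _)]mulr_natr.
by rewrite le_eqVlt; apply/orP; left; apply/eqP; ring.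
Qed.

End ThetaBound.

(** * Algebra of the curvature form and its trace *)

Section CurvatureForm.
Variables (R : realType) (E : lmodType R) (c kappa mu a b : R).
Variables (g f h k al rho : E -> E -> R) (et pi : E -> R) (q : E -> E -> E -> E -> R).
Implicit Types (u v w t : E).

(** The right side of the Gauss equation with the space form curvature, over abstract scalar forms.
    Their intended values are g(u, v), f = g(u, phi v), h = g(h' u, v), k = g(phi h' u, v), al =
    alpha', rho = pi of the second fundamental form, and q the inner product of two of its
    values. *)
Definition curvature_form u v w t : R :=
  (c + 3) / 4 * (g v w * g u t - g u w * g v t)
  + (c + 3 - 4 * kappa) / 4 * (et u * et w * g v t - et v * et w * g u t
      + g u w * et v * et t - g v w * et u * et t)
  + (c - 1) / 4 * (2 * f u v * f t w + f u w * f t v - f v w * f t u)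
  + 2^-1 * (h v w * h u t - h u w * h v t + k u w * k v t - k v w * k u t)
  - g u w * h v t + g v w * h u t + et u * et w * h v t - et v * et w * h u t
  - h u w * g v t + h v w * g u t - h v w * et u * et t + h u w * et v * et t
  + mu * (et v * et w * h u t - et u * et w * h v t + h v w * et u * et t - h u w * et v * et t)
  + a * (al u v - al v u) * g w t + b * al u w * g v t - b * al v w * g u t
  + b ^+ 2 * pi w * (pi v * g u t - pi u * g v t)
  + q v w u t - q u w v t - b * rho v w * g u t + b * rho u w * g v t.

Section Linearity.
Definition bilinear_form (s : E -> E -> R) :=
  (forall x u v w, s (x *: u + v) w = x * s u w + s v w) /\
  (forall x u v w, s w (x *: u + v) = x * s w u + s w v).
Hypotheses (gB : bilinear_form g) (fB : bilinear_form f) (hB : bilinear_form h).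
Hypotheses (kB : bilinear_form k) (alB : bilinear_form al) (rhoB : bilinear_form rho).
Hypothesis etL : forall x u v, et (x *: u + v) = x * et u + et v.
Hypothesis piL : forall x u v, pi (x *: u + v) = x * pi u + pi v.
Hypothesis qB1 : forall u v, bilinear_form (q u v).
Hypothesis qB2 : forall u v, bilinear_form (fun w t => q w t u v).

Let expand := (gB.1, gB.2, fB.1, fB.2, hB.1, hB.2, kB.1, kB.2, alB.1, alB.2, rhoB.1,
  rhoB.2, etL, piL).

Lemma curvature_form_linear1 x u u' v w t :
  curvature_form (x *: u + u') v w t = x * curvature_form u v w t + curvature_form u' v w t.
Proof.
by rewrite /curvature_form !expand (qB1 _ _).1 (qB2 _ _).1; ring.
Qed.

Lemma curvature_form_linear2 x u v v' w t :
  curvature_form u (x *: v + v') w t = x * curvature_form u v w t + curvature_form u v' w t.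
Proof.
by rewrite /curvature_form !expand (qB1 _ _).1 (qB2 _ _).1; ring.
Qed.

Lemma curvature_form_linear3 x u v w w' t :
  curvature_form u v (x *: w + w') t = x * curvature_form u v w t + curvature_form u v w' t.
Proof.
by rewrite /curvature_form !expand !(qB2 _ _).2; ring.
Qed.

Lemma curvature_form_linear4 x u v w t t' :
  curvature_form u v w (x *: t + t') = x * curvature_form u v w t + curvature_form u v w t'.
Proof.
by rewrite /curvature_form !expand !(qB1 _ _).2; ring.
Qed.

End Linearity.

Hypothesis gS : forall u v, g u v = g v u.
Hypothesis hS : forall u v, h u v = h v u.
Hypothesis kS : forall u v, k u v = k v u.
Hypothesis fS : forall u v, f u v = - f v u.
Hypothesis qS1 : forall u v w t, q u v w t = q v u w t.
Hypothesis qS2 : forall u v w t, q u v w t = q w t u v.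

Definition sectional_form u v : R :=
  2^-1 * (curvature_form u v v u - curvature_form u v u v).

(** The difference in [sectional_form] symmetrises the terms in al, pi and rho. The term in a is
    multiplied by g(u, v) = 0. *)
Lemma sectional_form_orthonormal u v : g u u = 1 -> g v v = 1 -> g u v = 0 ->
  sectional_form u v = (c + 3) / 4 - (c + 3 - 4 * kappa) / 4 * (et u * et u + et v * et v)
  + 3 * (c - 1) / 4 * (f u v * f u v)
  + 2^-1 * (h u u * h v v - h u v * h u v + k u v * k u v - k u u * k v v)
  + (h u u + h v v)
  + (1 - mu) * (2 * (et u * (et v * h u v)) - (et v * et v * h u u + et u * et u * h v v))
  - b / 2 * (al u u + al v v) + b ^+ 2 / 2 * (pi u * pi u + pi v * pi v)
  - b / 2 * (rho u u + rho v v) + (q u u v v - q u v u v).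
Proof.
move=> guu gvv guv; rewrite /sectional_form /curvature_form (gS v u) (hS v u) (kS v u) guv guu gvv.
have fuu w : f w w = 0 by have := fS w w; lra.
have q1 : q u v v u = q u v u v by rewrite qS2 qS1.
rewrite (fS v u) !fuu (qS2 v v u u) q1 (qS1 v u u v).
by field.
Qed.

End CurvatureForm.

Section TraceOfCurvature.
Variables (R : realType) (E : lmodType R) (c kappa mu a b : R) (n : nat).
Variables (g f h k al rho : E -> E -> R) (et pi : E -> R) (q : E -> E -> E -> E -> R).
Variable e : 'I_n -> E.
Hypothesis gS : forall u v, g u v = g v u.
Hypothesis hS : forall u v, h u v = h v u.
Hypothesis kS : forall u v, k u v = k v u.
Hypothesis fS : forall u v, f u v = - f v u.
Hypothesis qS1 : forall u v w t, q u v w t = q v u w t.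
Hypothesis qS2 : forall u v w t, q u v w t = q w t u v.
Hypothesis e_on : forall i j, g (e i) (e j) = (i == j)%:R.

Lemma sum_sectional_form :
  \sum_i \sum_(j | j != i) sectional_form c kappa mu a b g f h k al rho et pi q (e i) (e j) =
  (c + 3) / 4 * (n%:R - 1) * n%:R
  - (c + 3 - 4 * kappa) / 2 * (n%:R - 1) * \sum_i et (e i) * et (e i)
  + 3 * (c - 1) / 4 * \sum_i \sum_j f (e i) (e j) * f (e i) (e j)
  + 2^-1 * (\sum_i \sum_j k (e i) (e j) * k (e i) (e j)
      - \sum_i \sum_j h (e i) (e j) * h (e i) (e j)
      + (\sum_i h (e i) (e i)) ^+ 2 - (\sum_i k (e i) (e i)) ^+ 2)
  + 2 * (n%:R - 1) * \sum_i h (e i) (e i)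
  + 2 * (1 - mu) * (\sum_i \sum_j et (e i) * (et (e j) * h (e i) (e j))
      - (\sum_i h (e i) (e i)) * \sum_i et (e i) * et (e i))
  - (n%:R - 1) * b * \sum_i al (e i) (e i)
  + (n%:R - 1) * b ^+ 2 * \sum_i pi (e i) * pi (e i)
  - b * (n%:R - 1) * \sum_i rho (e i) (e i)
  + (\sum_i \sum_j q (e i) (e i) (e j) (e j) - \sum_i \sum_j q (e i) (e j) (e i) (e j)).
Proof.
(* The orthonormal formula is taken for all pairs, including equal ones, so that the sum over j
   different from i is the full sum minus a diagonal term. *)
pose S u v := (c + 3) / 4 - (c + 3 - 4 * kappa) / 4 * (et u * et u + et v * et v)
  + 3 * (c - 1) / 4 * (f u v * f u v)
  + 2^-1 * (h u u * h v v - h u v * h u v + k u v * k u v - k u u * k v v)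
  + (h u u + h v v)
  + (1 - mu) * (2 * (et u * (et v * h u v)) - (et v * et v * h u u + et u * et u * h v v))
  - b / 2 * (al u u + al v v) + b ^+ 2 / 2 * (pi u * pi u + pi v * pi v)
  - b / 2 * (rho u u + rho v v) + (q u u v v - q u v u v).
have SE i : \sum_(j | j != i) sectional_form c kappa mu a b g f h k al rho et pi q (e i) (e j)
    = \sum_j S (e i) (e j) - S (e i) (e i).
  rewrite [X in _ = X - _](bigD1 i) //= addrAC subrr add0r; apply: eq_bigr => j ji.
  by rewrite sectional_form_orthonormal // ?e_on ?eqxx // eq_sym (negPf ji).
have fuu w : f w w = 0 by have := fS w w; lra.
under eq_bigr do rewrite SE.
(* Linearity of the sum is proved by induction on an arbitrary list, the sum of ones standing for
   its length; [ring] then handles each step. *)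
have sumS i (r : seq 'I_n) : \sum_(j <- r) S (e i) (e j) =
    (c + 3) / 4 * (\sum_(j <- r) 1)
      - (c + 3 - 4 * kappa) / 4 * ((\sum_(j <- r) 1) * (et (e i) * et (e i))
      + (\sum_(j <- r) et (e j) * et (e j)))
    + 3 * (c - 1) / 4 * (\sum_(j <- r) f (e i) (e j) * f (e i) (e j))
    + 2^-1 * (h (e i) (e i) * (\sum_(j <- r) h (e j) (e j))
      - (\sum_(j <- r) h (e i) (e j) * h (e i) (e j))
       + (\sum_(j <- r) k (e i) (e j) * k (e i) (e j)) - k (e i) (e i) * (\sum_(j <- r) k (e j) (e j)))
    + ((\sum_(j <- r) 1) * h (e i) (e i) + (\sum_(j <- r) h (e j) (e j)))
    + (1 - mu) * (2 * (\sum_(j <- r) et (e i) * (et (e j) * h (e i) (e j)))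
      - ((\sum_(j <- r) et (e j) * et (e j)) * h (e i) (e i)
        + et (e i) * et (e i) * (\sum_(j <- r) h (e j) (e j))))
    - b / 2 * ((\sum_(j <- r) 1) * al (e i) (e i) + (\sum_(j <- r) al (e j) (e j)))
      + b ^+ 2 / 2 * ((\sum_(j <- r) 1) * (pi (e i) * pi (e i))
      + (\sum_(j <- r) pi (e j) * pi (e j)))
    - b / 2 * ((\sum_(j <- r) 1) * rho (e i) (e i) + (\sum_(j <- r) rho (e j) (e j)))
    + ((\sum_(j <- r) q (e i) (e i) (e j) (e j)) - \sum_(j <- r) q (e i) (e j) (e i) (e j)).
  elim: r => [|j r IH]; first by rewrite !big_nil; ring.
  by rewrite !big_cons IH /S; ring.
have SiiE i : S (e i) (e i) = (c + 3) / 4 - (c + 3 - 4 * kappa) / 2 * (et (e i) * et (e i))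
    + 2 * h (e i) (e i) - b * al (e i) (e i) + b ^+ 2 * (pi (e i) * pi (e i)) - b * rho (e i) (e i).
  by rewrite /S fuu; field.
(* In the outer sum the totals over j are constants. They are named as variables so that the
   induction on the list leaves them fixed. *)
have sumT (N tet th tk tal tpi trho : R) (r : seq 'I_n) : \sum_(i <- r)
    ((c + 3) / 4 * N - (c + 3 - 4 * kappa) / 4 * (N * (et (e i) * et (e i)) + tet)
      + 3 * (c - 1) / 4 * (\sum_j f (e i) (e j) * f (e i) (e j))
      + 2^-1 * (h (e i) (e i) * th - (\sum_j h (e i) (e j) * h (e i) (e j))
         + (\sum_j k (e i) (e j) * k (e i) (e j)) - k (e i) (e i) * tk)
      + (N * h (e i) (e i) + th)
      + (1 - mu) * (2 * (\sum_j et (e i) * (et (e j) * h (e i) (e j)))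
        - (tet * h (e i) (e i) + et (e i) * et (e i) * th))
      - b / 2 * (N * al (e i) (e i) + tal) + b ^+ 2 / 2 * (N * (pi (e i) * pi (e i)) + tpi)
      - b / 2 * (N * rho (e i) (e i) + trho)
      + ((\sum_j q (e i) (e i) (e j) (e j)) - \sum_j q (e i) (e j) (e i) (e j))
      - ((c + 3) / 4 - (c + 3 - 4 * kappa) / 2 * (et (e i) * et (e i))
    + 2 * h (e i) (e i) - b * al (e i) (e i) + b ^+ 2 * (pi (e i) * pi (e i)) - b * rho (e i) (e i))) =
    (c + 3) / 4 * N * (\sum_(i <- r) 1)
      - (c + 3 - 4 * kappa) / 4 * (N * (\sum_(i <- r) et (e i) * et (e i))
      + (\sum_(i <- r) 1) * tet)
      + 3 * (c - 1) / 4 * (\sum_(i <- r) \sum_j f (e i) (e j) * f (e i) (e j))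
      + 2^-1 * ((\sum_(i <- r) h (e i) (e i)) * th
        - (\sum_(i <- r) \sum_j h (e i) (e j) * h (e i) (e j))
         + (\sum_(i <- r) \sum_j k (e i) (e j) * k (e i) (e j))
           - (\sum_(i <- r) k (e i) (e i)) * tk)
      + (N * (\sum_(i <- r) h (e i) (e i)) + (\sum_(i <- r) 1) * th)
      + (1 - mu) * (2 * (\sum_(i <- r) \sum_j et (e i) * (et (e j) * h (e i) (e j)))
        - (tet * (\sum_(i <- r) h (e i) (e i)) + (\sum_(i <- r) et (e i) * et (e i)) * th))
      - b / 2 * (N * (\sum_(i <- r) al (e i) (e i)) + (\sum_(i <- r) 1) * tal)
        + b ^+ 2 / 2 * (N * (\sum_(i <- r) pi (e i) * pi (e i)) + (\sum_(i <- r) 1) * tpi)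
      - b / 2 * (N * (\sum_(i <- r) rho (e i) (e i)) + (\sum_(i <- r) 1) * trho)
      + ((\sum_(i <- r) \sum_j q (e i) (e i) (e j) (e j))
        - (\sum_(i <- r) \sum_j q (e i) (e j) (e i) (e j)))
      - ((c + 3) / 4 * (\sum_(i <- r) 1)
        - (c + 3 - 4 * kappa) / 2 * (\sum_(i <- r) et (e i) * et (e i))
        + 2 * (\sum_(i <- r) h (e i) (e i)) - b * (\sum_(i <- r) al (e i) (e i))
         + b ^+ 2 * (\sum_(i <- r) pi (e i) * pi (e i)) - b * (\sum_(i <- r) rho (e i) (e i))).
  elim: r => [|i r IH]; first by rewrite !big_nil; ring.
  by rewrite !big_cons IH; ring.
under eq_bigr do rewrite sumS SiiE.
rewrite sumT (_ : \sum_i 1 = n%:R) ?sumr_const ?card_ord //.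
by field.
Qed.

End TraceOfCurvature.

Lemma Theta_le_sum_Ksub (R : realType) (n d : nat)
  (G : 'rV[R]_d -> 'M[R]_d) (F : 'rV[R]_n -> 'rV[R]_d)
  (Gam : 'rV[R]_d -> 'rV[R]_d -> 'rV[R]_d -> 'rV[R]_d) (p : 'rV[R]_n)
  (e : 'I_n -> 'rV[R]_n) (k : nat) :
  (induced_metric G F p)^T = induced_metric G F p ->
  (forall i j, bform (induced_metric G F p) (e i) (e j) = (i == j)%:R) ->
  (forall c u u' v w t, Rsub G F Gam p (c *: u + u') v w t =
     c * Rsub G F Gam p u v w t + Rsub G F Gam p u' v w t) ->
  (forall c u v v' w t, Rsub G F Gam p u (c *: v + v') w t =
     c * Rsub G F Gam p u v w t + Rsub G F Gam p u v' w t) ->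
  (forall c u v w w' t, Rsub G F Gam p u v (c *: w + w') t =
     c * Rsub G F Gam p u v w t + Rsub G F Gam p u v w' t) ->
  (forall c u v w t t', Rsub G F Gam p u v w (c *: t + t') =
     c * Rsub G F Gam p u v w t + Rsub G F Gam p u v w t') ->
  (2 <= k <= n)%N ->
  n%:R * (n%:R - 1) * Theta G F Gam p k <=
  \sum_i \sum_(j | j != i) Ksub G F Gam p (e i) (e j).
Proof.
case: n F p e => [|[|n]] F p e AT e_on T1 T2 T3 T4 k2.
- by case: k k2 => [|[|k]].
- by case: k k2 => [|[|k]].
- exact (Theta_le AT e_on T1 T2 T3 T4 k2).
Qed.

(** * The inequality at a point of a chart *)

Section AlphaBilinear.
Variables (R : realType) (d : nat) (V : set 'rV[R]_d).
Variables (G : 'rV[R]_d -> 'M[R]_d) (P : 'rV[R]_d -> 'rV[R]_d).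
Hypotheses (oV : open V) (sG : smooth_on V G) (sP : smooth_on V P).
Hypothesis GT : forall y, V y -> (G y)^T = G y.
Hypothesis uG : forall y, V y -> G y \in unitmx.
Variable y : 'rV[R]_d.
Hypothesis Vy : V y.

Lemma pi_form_linear z x u v : pi_form G P z (x *: u + v) = x * pi_form G P z u + pi_form G P z v.
Proof. by rewrite /pi_form bformDr bformZr. Qed.

Lemma alpha'_bilinear : bilinear_form (alpha' G P y).
Proof.
have dpi v : differentiable (fun z => pi_form G P z v) y.
  exact: (differentiable_pi_form sG sP v Vy).
split=> c u v w; rewrite !alpha'E.
- have -> : 'D_(c *: u + v) (fun z => pi_form G P z w) y =
      c * 'D_u (fun z => pi_form G P z w) y + 'D_v (fun z => pi_form G P z w) y.
    by apply: etrans (deriveDl _ _ (dpi w)) _; congr (_ + _); exact: deriveZdir.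
  rewrite (LC_linearl oV sG GT uG c u v w Vy) pi_form_linear.
  move: ('D_u _ y) ('D_v _ y) (pi_form _ _ _ _) (pi_form _ _ _ _).
  by move=> *; ring.
- have -> : 'D_w (fun z => pi_form G P z (c *: u + v)) y =
      c * 'D_w (fun z => pi_form G P z u) y + 'D_w (fun z => pi_form G P z v) y.
    have -> : (fun z => pi_form G P z (c *: u + v)) =
        (fun z => c *: pi_form G P z u + pi_form G P z v).
      by apply/funext => z; rewrite /pi_form bformDr bformZr.
    have d1 t : derivable (fun z => pi_form G P z t) y w by exact: diff_derivable.
    have DD (f1 f2 : 'rV[R]_d -> R) : derivable f1 y w -> derivable f2 y w ->
        'D_w (fun z => c *: f1 z + f2 z) y = c * 'D_w f1 y + 'D_w f2 y.
      move=> df1 df2; have D1 := deriveZ c df1.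
      have D2 : derivable (c \*: f1) y w by exact: derivableZ.
      by have := deriveD D2 df2; rewrite D1.
    exact (DD _ _ (d1 u) (d1 v)).
  rewrite (LC_linearr oV sG GT uG c u v w Vy) pi_form_linear.
  move: ('D_w _ y) ('D_w _ y) (pi_form _ _ _ _) (pi_form _ _ _ _).
  by move=> *; ring.
Qed.

End AlphaBilinear.

Section Pointwise.
Variables (R : realType) (n d : nat) (U : set 'rV[R]_n) (V : set 'rV[R]_d).
Variables (F : 'rV[R]_n -> 'rV[R]_d) (G : 'rV[R]_d -> 'M[R]_d).
Variables (P : 'rV[R]_d -> 'rV[R]_d) (a b c kappa mu : R).
Hypotheses (oU : open U) (oV : open V) (FUV : forall q, U q -> V (F q)).
Hypotheses (sF : smooth_on U F) (sG : smooth_on V G) (sP : smooth_on V P).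
Hypothesis rfF : forall q, U q -> row_free (jacobian F q).
Hypothesis GT : forall y, V y -> (G y)^T = G y.
Hypothesis G_gt0 : forall y u, V y -> u != 0 -> 0 < bform (G y) u u.
Variable p : 'rV[R]_n.
Hypothesis Up : U p.
Local Notation y := (F p).
Variables (phi : 'rV[R]_d -> 'M[R]_d) (xi : 'rV[R]_d -> 'rV[R]_d).
Variables (eta : 'rV[R]_d -> 'cV[R]_d) (H : 'M[R]_d).
Hypothesis riemannE : forall u v w,
  riemann G y u v w = space_form_curvature G phi xi eta kappa mu c y u v w.
Hypothesis hE : forall u, hprime xi phi y u = u *m H.
Hypothesis HS : (H *m G y)^T = H *m G y.
Hypothesis HphiS : (H *m phi y *m G y)^T = H *m phi y *m G y.
Hypothesis phi_skew : forall u v,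
  bform (G y) u (v *m phi y) = - bform (G y) (u *m phi y) v.
Hypothesis G_xi : forall u, bform (G y) u (xi y) = cov_at (eta y) u.
Implicit Types (u v w t : 'rV[R]_n).

Local Notation J := (pushv F p).
Local Notation gN := (bform (G y)).
Local Notation gM := (bform (induced_metric G F p)).
Local Notation Gam := (tilde_conn G P a b).

(* Opaque names for the second fundamental form and alpha', which keep        *)
(* conversion from unfolding the derivatives they are made of.                *)
Variable II : 'rV[R]_n -> 'rV[R]_n -> 'rV[R]_d.
Hypothesis IIE : forall u v, second_form G F Gam (cst u) (cst v) p = II u v.
Variable al : 'rV[R]_n -> 'rV[R]_n -> R.
Hypothesis alE : forall u v, alpha' G P y (J u) (J v) = al u v.

Let Vy : V y := FUV Up.
Let uG z : V z -> G z \in unitmx.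
Proof. by move=> Vz; apply: posdef_unitmx => u; exact: G_gt0. Qed.

Let g u v := gN (J u) (J v).
Let f u v := gN (J u) (J v *m phi y).
Let h u v := gN (J u *m H) (J v).
Let k u v := gN (J u *m H *m phi y) (J v).
Let et u := cov_at (eta y) (J u).
Let pi u := pi_form G P y (J u).
Let rho u v := pi_form G P y (II u v).
Let q u v w t := gN (II u v) (II w t).

Let gNS (u v : 'rV[R]_d) : gN u v = gN v u. Proof. by apply: bform_sym; exact: GT. Qed.

Let hS u v : h u v = h v u.
Proof.
have bE s r : gN (s *m H) r = bform (H *m G y) s r by rewrite /bform !mulmxA.
by rewrite /h !bE bform_sym.
Qed.

Let kS u v : k u v = k v u.
Proof.
have bE s r : gN (s *m H *m phi y) r = bform (H *m phi y *m G y) s r by rewrite /bform !mulmxA.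
by rewrite /k !bE bform_sym.
Qed.

Let fS u v : f u v = - f v u.
Proof. by rewrite /f phi_skew gNS. Qed.

Let gS u v : g u v = g v u. Proof. exact: gNS. Qed.

Let IIS u v : II u v = II v u.
Proof.
exact (etrans (esym (IIE u v)) (etrans
  (second_form_sym P a b oU oV FUV sF sG rfF GT G_gt0 u v Up) (IIE v u))).
Qed.

Let IIL x u v w : II (x *: u + v) w = x *: II u w + II v w.
Proof.
rewrite -(IIE u) -(IIE v) -IIE.
exact (second_form_linear P a b oU oV FUV sF sG GT G_gt0 x u v w Up).
Qed.

Let J_linear x u v : J (x *: u + v) = x *: J u + J v.
Proof. by rewrite /pushv mulmxDl scalemxAl. Qed.

Let form := curvature_form c kappa mu a b g f h k al rho et pi q.

(** Gauss equation, curvature of the modified connection and space form curvature are substituted in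
    turn; the rest is bilinear expansion. *)
Let RsubE u v w t : Rsub G F Gam p u v w t = form u v w t.
Proof.
rewrite (gauss_equation a b oU oV FUV sF sG sP rfF GT G_gt0 u v w t Up) !IIE.
rewrite (tilde_curvature a b oV sG sP GT uG (J u) (J v) (J w) Vy) !alE riemannE.
rewrite /space_form_curvature !hE.
have xiE s : gN (xi y) s = cov_at (eta y) s by rewrite gNS G_xi.
rewrite !(bformDl, bformZl, bformNl, xiE) (gNS (J w *m phi y)).
rewrite (gNS (J v *m phi y)) (gNS (J u *m phi y)).
rewrite /form /curvature_form /g /f /h /k /et /pi /rho /q.
by ring.
Qed.

Let gB : bilinear_form g.
Proof.
by split=> x u v w; rewrite /g J_linear ?(bformDl, bformZl, bformDr, bformZr).
Qed.

Let fB : bilinear_form f.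
Proof.
by split=> x u v w; rewrite /f J_linear ?mulmxDl -?scalemxAl ?(bformDl, bformZl, bformDr, bformZr).
Qed.

Let hB : bilinear_form h.
Proof.
by split=> x u v w; rewrite /h J_linear ?mulmxDl -?scalemxAl ?(bformDl, bformZl, bformDr, bformZr).
Qed.

Let kB : bilinear_form k.
Proof.
by split=> x u v w; rewrite /k J_linear ?mulmxDl -?scalemxAl ?(bformDl, bformZl, bformDr, bformZr).
Qed.

Let alB : bilinear_form al.
Proof.
have [B1 B2] := alpha'_bilinear oV sG sP GT uG Vy.
by split=> x u v w; rewrite -!alE J_linear ?B1 ?B2.
Qed.

Let IIR x u v w : II w (x *: u + v) = x *: II w u + II w v.
Proof. by rewrite IIS IIL !(IIS _ w). Qed.

Let rhoB : bilinear_form rho.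
Proof.
by split=> x u v w; rewrite /rho ?IIL ?IIR pi_form_linear.
Qed.

Let qB1 u v : bilinear_form (q u v).
Proof.
by split=> x u' v' w; rewrite /q ?IIL ?IIR bformDr bformZr.
Qed.

Let qB2 u v : bilinear_form (fun w t => q w t u v).
Proof.
by split=> x u' v' w; rewrite /q ?IIL ?IIR bformDl bformZl.
Qed.

Let etL x u v : et (x *: u + v) = x * et u + et v.
Proof. by rewrite /et -!G_xi J_linear bformDl bformZl. Qed.

Let piL x u v : pi (x *: u + v) = x * pi u + pi v.
Proof. by rewrite /pi J_linear pi_form_linear. Qed.

Let gN_ge0 z : 0 <= gN z z.
Proof.
by have [->|z0] := eqVneq z 0; [rewrite bform0l|apply: ltW; exact: G_gt0].
Qed.

Variable e : 'I_n -> 'rV[R]_n.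
Hypothesis e_on : orthonormal_basis G F p e.
Variable r : nat.
Hypothesis r_len : (2 <= r <= n)%N.

Let AT : (induced_metric G F p)^T = induced_metric G F p.
Proof. by rewrite /induced_metric !trmx_mul trmxK GT // mulmxA. Qed.

Let gE u v : gM u v = g u v. Proof. exact: induced_metricE. Qed.

Let qS1 u v w t : q u v w t = q v u w t. Proof. by rewrite /q IIS. Qed.
Let qS2 u v w t : q u v w t = q w t u v. Proof. exact: gNS. Qed.

Let sum_Ksub := sum_sectional_form c kappa mu a b al rho et pi gS hS kS fS qS1 qS2
  (fun i j => etrans (esym (gE (e i) (e j))) (e_on i j)).

Let Theta_le_form : n%:R * (n%:R - 1) * Theta G F Gam p r <= \sum_i \sum_(j | j != i)
  sectional_form c kappa mu a b g f h k al rho et pi q (e i) (e j).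
Proof.
have := @Theta_le_sum_Ksub R n d G F Gam p e r AT e_on.
have -> : \sum_i \sum_(j | j != i) Ksub G F Gam p (e i) (e j) = \sum_i \sum_(j | j != i)
    sectional_form c kappa mu a b g f h k al rho et pi q (e i) (e j).
  by apply: eq_bigr => i _; apply: eq_bigr => j _; rewrite /Ksub !RsubE.
apply => //.
- by move=> *; rewrite !RsubE; apply: curvature_form_linear1; assumption.
- by move=> *; rewrite !RsubE; apply: curvature_form_linear2; assumption.
- by move=> *; rewrite !RsubE; apply: curvature_form_linear3; assumption.
- by move=> *; rewrite !RsubE; apply: curvature_form_linear4; assumption.
Qed.

Let mean := n%:R^-1 *: \sum_i II (e i) (e i).

Let n_neq0 : n%:R != 0 :> R.
Proof.
have /andP[r2 rn] := r_len.
by rewrite pnatr_eq0 -lt0n (leq_trans _ rn) // ltnW.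
Qed.

Let sum_II : \sum_i II (e i) (e i) = n%:R *: mean.
Proof. by rewrite /mean scalerA divff // scale1r. Qed.

Let sum_q : \sum_i \sum_j q (e i) (e i) (e j) (e j) = n%:R ^+ 2 * gN mean mean.
Proof.
under eq_bigr do rewrite -bform_sumr sum_II.
by rewrite -bform_suml sum_II bformZl bformZr mulrA expr2.
Qed.

Let sum_rho : \sum_i rho (e i) (e i) = n%:R * pi_form G P y mean.
Proof. by rewrite /rho /pi_form -bform_sumr sum_II bformZr. Qed.

(* Cauchy-Schwarz for the diagonal part, as positivity of the variance.       *)
Let sum_q_ge : n%:R * gN mean mean <= \sum_i \sum_j q (e i) (e j) (e i) (e j).
Proof.
apply: (@le_trans _ _ (\sum_i q (e i) (e i) (e i) (e i))); last first.
  apply: ler_sum => i _; rewrite (bigD1 i) //= lerDl.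
  by apply: sumr_ge0 => j _; exact: gN_ge0.
have : 0 <= \sum_i gN (II (e i) (e i) - mean) (II (e i) (e i) - mean).
  by apply: sumr_ge0 => i _; exact: gN_ge0.
under eq_bigr do rewrite bformDl bformNl !bformDr !bformNr (gNS mean).
rewrite !(big_split, sumrN) /= -bform_suml sum_II bformZl sumr_const card_ord -mulr_natl.
rewrite /q; lra.
Qed.

Let hz := hprime xi phi y.
Let tr A := endo_trace G F p e (tan_endo G F p A).
Let norm2 A := endo_norm2 G F p e (tan_endo G F p A).
Let xiT := tangential G F p (xi y).
Let PT := tangential G F p (P y).
Let H0 := mean_curvature G F Gam p e.

(** [Theta_le_form] bounds n(n-1) Theta_k by the trace, whose part quadratic in the second
    fundamental form is n^2 |H|^2 minus the squared norm; [sum_q_ge] bounds that norm below by n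
    |H|^2. *)
Lemma mean_curvature_bound :
  n%:R * (n%:R - 1) * gN H0 H0 >=
    n%:R * (n%:R - 1) * Theta G F Gam p r
    - (c + 3) / 4 * (n%:R - 1) * n%:R
    - 3 * (c - 1) / 4 * norm2 (fun z => z *m phi y)
    + (c + 3 - 4 * kappa) / 2 * (n%:R - 1) * gM xiT xiT
    - 2^-1 * (norm2 (fun z => hz z *m phi y) - norm2 hz
        + `|tr hz| ^+ 2 - `|tr (fun z => hz z *m phi y)| ^+ 2)
    - 2 * (n%:R - 1) * tr hz
    - 2 * (1 - mu) * (gN (J xiT) (hz (J xiT)) - tr hz * gM xiT xiT)
    + (n%:R - 1) * b * (\sum_l alpha' G P y (J (e l)) (J (e l)))
    - (n%:R - 1) * b ^+ 2 * gM PT PT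
    + b * (n%:R - 1) * n%:R * pi_form G P y H0.
Proof.
(* Products with a tangential part are ambient products, so each trace and norm of the statement
   becomes a sum of values of the forms f, h, k, et and pi. *)
have tanE z u : gM u (tangential G F p z) = gN z (J u).
  by rewrite (bform_sym _ _ AT) (tangentialP FUV rfF G_gt0 z u Up).
have trE A : tr A = \sum_i gN (A (J (e i))) (J (e i)).
  by apply: eq_bigr => i _; rewrite /tan_endo tanE.
have normE A : norm2 A = \sum_i \sum_j gN (A (J (e j))) (J (e i)) * gN (A (J (e j))) (J (e i)).
  by apply: eq_bigr => i _; apply: eq_bigr => j _; rewrite /tan_endo tanE expr2.
have H0E : H0 = mean.
  by rewrite /H0 /mean_curvature /mean; congr (_ *: _); apply: eq_bigr => i _; exact: IIE.
have xiTe i : gM xiT (e i) = et (e i).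
  by rewrite (bform_sym _ _ AT) tanE gNS G_xi.
have xixi : gM xiT xiT = \sum_i et (e i) * et (e i).
  rewrite (orthonormal_bform AT e_on); apply: eq_bigr => i _.
  by rewrite (bform_sym (e i) xiT AT) xiTe.
have PP : gM PT PT = \sum_i pi (e i) * pi (e i).
  rewrite (orthonormal_bform AT e_on); apply: eq_bigr => i _.
  by rewrite (bform_sym PT (e i) AT) !tanE.
have xih : gN (J xiT) (hz (J xiT)) =
    \sum_i \sum_j et (e i) * (et (e j) * h (e i) (e j)).
  pose B := jacobian F p *m H *m G y *m (jacobian F p)^T.
  have hBE u v : h u v = bform B u v by rewrite /h /bform /pushv /B trmx_mul !mulmxA.
  rewrite /hz hE gNS -/(h xiT xiT) hBE (orthonormal_sum AT e_on xiT) bform_suml.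
  apply: eq_bigr => i _; rewrite bformZl bform_sumr mulr_sumr; apply: eq_bigr => j _.
  by rewrite bformZr !xiTe hBE.
rewrite H0E xixi PP xih !real_normK ?num_real // !normE !trE.
have -> : \sum_l alpha' G P y (J (e l)) (J (e l)) = \sum_i al (e i) (e i).
  by apply: eq_bigr => i _; rewrite alE.
have hzE u v : gN (hz (J u)) (J v) = h u v by rewrite /hz hE.
have hzphiE u v : gN (hz (J u) *m phi y) (J v) = k u v by rewrite /hz hE.
(* [norm2] applies the endomorphism to e_j and pairs with e_i. The order of the arguments is
   restored by symmetry of the metric here and by that of h and k in the next two sums. *)
have -> : \sum_i \sum_j gN (J (e j) *m phi y) (J (e i)) * gN (J (e j) *m phi y) (J (e i)) =
    \sum_i \sum_j f (e i) (e j) * f (e i) (e j).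
  by apply: eq_bigr => i _; apply: eq_bigr => j _; rewrite gNS.
have -> : \sum_i \sum_j gN (hz (J (e j))) (J (e i)) * gN (hz (J (e j))) (J (e i)) =
    \sum_i \sum_j h (e i) (e j) * h (e i) (e j).
  by apply: eq_bigr => i _; apply: eq_bigr => j _; rewrite hzE hS.
have -> : \sum_i \sum_j gN (hz (J (e j)) *m phi y) (J (e i)) * gN (hz (J (e j)) *m phi y) (J (e i)) =
    \sum_i \sum_j k (e i) (e j) * k (e i) (e j).
  by apply: eq_bigr => i _; apply: eq_bigr => j _; rewrite hzphiE kS.
have -> : \sum_i gN (hz (J (e i))) (J (e i)) = \sum_i h (e i) (e i).
  by apply: eq_bigr => i _; rewrite hzE.
have -> : \sum_i gN (hz (J (e i)) *m phi y) (J (e i)) = \sum_i k (e i) (e i).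
  by apply: eq_bigr => i _; rewrite hzphiE.
(* Once every sum is a variable, the conclusion is a linear combination of these two
   inequalities. *)
have := Theta_le_form; rewrite sum_Ksub sum_q sum_rho; have := sum_q_ge.
move: (\sum_i \sum_j q (e i) (e j) (e i) (e j)) (gN mean mean) => Q hh.
move: (pi_form G P y mean) (Theta G F Gam p r) => pimean theta.
do ![move: (\sum_i _)]; move: (n%:R : R) => N *; lra.
Qed.

End Pointwise.

(** * From the manifolds to the chosen charts *)

(** Inside the open range of the chart, this image is the preimage of O under the continuous inverse
    chart. *)
Lemma open_chart_image (R : realType) (d : nat) (M : manifold R d) (i : chart M)
  (O : set M) : open O -> open (chart_map i @` (chart_dom i `&` O)).
Proof.
move=> oO; have oV := @mfd_range_open _ _ M i; rewrite openE => _ [x [ix Ox] <-].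
have Vx : (chart_map i @` chart_dom i) (chart_map i x) by exists x.
have cinv : {for chart_map i x, continuous (chart_inv i)}.
  have := @mfd_param_continuous _ _ M i; rewrite continuous_open_subspace //.
  by apply; rewrite inE.
have nO : nbhs (chart_map i x) [set q | O (chart_inv i q)].
  by apply: cinv; rewrite mfd_coordK //; exact: open_nbhs_nbhs.
apply: filterS2 (open_nbhs_nbhs (conj oV Vx)) nO => _ [z iz <-] /=.
by rewrite mfd_coordK // => Oz; exists z.
Qed.

Theorem theorem4p3 (R : realType) (m n : nat) (kappa mu c a b : R)
  (N : manifold R (2 * m).+1)
  (phi : chart N -> 'rV[R]_((2 * m).+1) -> 'M[R]_((2 * m).+1))
  (xi : chart N -> 'rV[R]_((2 * m).+1) -> 'rV[R]_((2 * m).+1))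
  (eta : chart N -> 'rV[R]_((2 * m).+1) -> 'cV[R]_((2 * m).+1))
  (g : chart N -> 'rV[R]_((2 * m).+1) -> 'M[R]_((2 * m).+1))
  (hN : contact_space_form phi xi eta g kappa mu c)
  (P : chart N -> 'rV[R]_((2 * m).+1) -> 'rV[R]_((2 * m).+1))
  (hP : vector_field P)
  (M : manifold R n) (hn : (3 <= n)%N)
  (f : M -> N) (hf : immersion f)
  (k : nat) (hk : (2 <= k <= n)%N)
  (x : M) (i : chart M) (j : chart N)
  (hi : chart_dom i x) (hj : chart_dom j (f x))
  (e : 'I_n -> 'rV[R]_n)
  (he : orthonormal_basis (g j) (local_expr f i j) (chart_map i x) e) :
  let F := local_expr f i j in
  let p := chart_map i x in
  let y := F p in
  let G := g j in
  let gN := bform (G y) in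
  let gM := bform (induced_metric G F p) in
  let Gam := tilde_conn G (P j) a b in
  let H := mean_curvature G F Gam p e in
  let Theta_k := Theta G F Gam p k in
  let h := hprime (xi j) (phi j) y in
  let Phat := tan_endo G F p (fun z => z *m phi j y) in
  let hT := tan_endo G F p h in
  let phihT := tan_endo G F p (fun z => h z *m phi j y) in
  let norm2 := endo_norm2 G F p e in
  let tr := endo_trace G F p e in
  let xiT := tangential G F p (xi j y) in
  let PT := tangential G F p (P j y) in
  let lambda := \sum_l alpha' G (P j) y (pushv F p (e l)) (pushv F p (e l)) in
  n%:R * (n%:R - 1) * gN H H >=
    n%:R * (n%:R - 1) * Theta_k
    - (c + 3) / 4 * (n%:R - 1) * n%:R
    - 3 * (c - 1) / 4 * norm2 Phat
    + (c + 3 - 4 * kappa) / 2 * (n%:R - 1) * gM xiT xiT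
    - 2^-1 * (norm2 phihT - norm2 hT + `|tr hT| ^+ 2 - `|tr phihT| ^+ 2)
    - 2 * (n%:R - 1) * tr hT
    - 2 * (1 - mu) *
        (gN (pushv F p xiT) (h (pushv F p xiT)) - tr hT * gM xiT xiT)
    + (n%:R - 1) * b * lambda
    - (n%:R - 1) * b ^+ 2 * gM PT PT
    + b * (n%:R - 1) * n%:R * pi_form G (P j) y H.
Proof.
have [[[acm contact_eq] _] _ riemannE] := hN.
have [[sg _ gT g_gt0] [sphi _] [sxi _] [seta _] phi2 eta_xi phi_xi eta_phi skew g_xi] := acm.
have [sP _] := hP.
have [cf imm] := hf.
pose V := crange j.
pose U := chart_map i @` (chart_dom i `&` f @^-1` chart_dom j).
have oV : open V by exact: mfd_range_open.
have oU : open U.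
  apply: open_chart_image; apply: open_comp => [z _|]; first exact: cf.
  exact: mfd_dom_open.
have [sF rfF] := imm i j.
have FUV q : U q -> V (local_expr f i j q).
  move=> [z [iz fz] <-]; rewrite /local_expr /= mfd_coordK //.
  by exists (f z).
have Up : U (chart_map i x) by exists x.
have Vy := FUV _ Up.
(* The structure equations, stated on vectors, are turned into matrix identities by testing them on
   the standard basis or as bilinear forms. *)
have phi2m z : V z -> phi j z *m phi j z = eta j z *m xi j z - 1%:M.
  move=> Vz; apply/row_matrixP => l; rewrite !rowE mulmxA phi2 // mulmxBr mulmx1 mulmxA addrC.
  by congr (_ - _); rewrite [X in X *m _]mx11_scalar mul_scalar_mx.
have xi_eta z : V z -> xi j z *m eta j z = 1%:M.
  by move=> Vz; rewrite [LHS]mx11_scalar -/(cov_at _ _) eta_xi.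
have phi_eta z : V z -> phi j z *m eta j z = 0.
  move=> Vz; apply/row_matrixP => l; rewrite rowE row0 mulmxA [LHS]mx11_scalar.
  by rewrite -/(cov_at _ _) eta_phi // raddf0.
have G_phi z : V z -> g j z *m (phi j z)^T = - (phi j z *m g j z).
  move=> Vz; apply: mx_eq_bform => u v.
  have -> : bform (g j z *m (phi j z)^T) u v = bform (g j z) u (v *m phi j z).
    by rewrite /bform trmx_mul !mulmxA.
  by rewrite skew // /bform mulmxN mulNmx [RHS]mxE !mulmxA.
have G_xi z : V z -> g j z *m (xi j z)^T = eta j z.
  move=> Vz; apply/row_matrixP => l; rewrite !rowE.
  rewrite [LHS]mx11_scalar [RHS]mx11_scalar; congr (_%:M).
  by rewrite -/(cov_at (eta j z) _) -g_xi // /bform mulmxA.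
(* On constant fields the bracket term of [ext_deriv] vanishes. Skewness of phi changes the sign of
   the left side, which exchanges u and v on the right. *)
have contact z u v : V z -> u *m (phi j z *m g j z) *m v^T =
    2^-1 *: (u *m 'D_v (eta j) z - v *m 'D_u (eta j) z).
  move=> Vz.
  have deta : differentiable (eta j) z by exact: smooth_on_differentiable (seta j) Vz.
  have D s t : 'D_s (fun r => cov_at (eta j r) t) z = (t *m 'D_s (eta j) z) 0 0.
    rewrite /cov_at -derive_mulmxr //; apply: esym; apply: derive_mxE.
    by apply: differentiable_mulmx => //; exact: differentiable_cst.
  have E : (u *m (phi j z *m g j z) *m v^T) 0 0 = - bform (g j z) u (v *m phi j z).
    by rewrite /bform trmx_mul !mulmxA -(mulmxA u (g j z)) G_phi // mulmxN mulNmx [in RHS]mxE opprK mulmxA.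
  have subE (A B : 'M[R]_1) : (2^-1 *: (A - B)) 0 0 = 2^-1 * (A 0 0 - B 0 0) by rewrite !mxE.
  rewrite [LHS]mx11_scalar [RHS]mx11_scalar; congr (_%:M).
  rewrite E contact_eq // /ext_deriv lie_bracket_cst subE !D /cov_at /= mul0mx [X in _ - X]mxE.
  by rewrite subr0 -mulrN opprB.
have gTj z : V z -> (g j z)^T = g j z by exact: gT.
have hE := hprimeE (sphi j) (sxi j) Vy.
have hS := hprime_sym oV (sphi j) (sg j) (sxi j) (seta j) gTj phi2m xi_eta phi_eta G_phi G_xi
  contact Vy.
have phihS := phi_hprime_sym oV (sphi j) (sg j) (sxi j) (seta j) gTj phi_eta G_phi G_xi contact Vy.
exact (mean_curvature_bound oU oV FUV sF (sg j) (sP j) rfF gTj (fun z u Vz => g_gt0 j z u Vz) Up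
  (fun u v w => riemannE j _ u v w Vy) hE hS phihS (fun u v => skew j _ u v Vy)
  (fun u => g_xi j _ u Vy) (fun u v => erefl) (fun u v => erefl) he hk).
Qed.
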